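(* Let $J$ be a positive-definite (symmetric) $n\times n$ matrix with $\|J\|_{\mathrm{OP}}<\frac12$ and let $v\in\mathbb R^n$. Then the Glauber dynamics for $\nu=\nu_{J,v}$ mixes in time $O(n\log n)$. That is: for every $q\in(0,\frac12)$ and $\varepsilon\in(0,1)$ there is a constant $C=C(q,\varepsilon)$ such that for all $n\ge2$, all positive-definite $n\times n$ matrices $J$ with $\|J\|_{\mathrm{OP}}\le q$ and all $v\in\mathbb R^n$, $t_{\mathrm{mix}}(P^{\mathrm{GD}}(\nu_{J,v}),\varepsilon)\le C\,n\log n$.
   Context: For a symmetric $n\times n$ matrix $J$ and $v\in\mathbb R^n$, $\nu_{J,v}$ is the Ising measure on $\{-1,1\}^n$ given by $\nu_{J,v}(\{x\})\propto\exp(\langle x,Jx\rangle+\langle x,v\rangle)$. $\|\cdot\|_{\mathrm{OP}}$ is the operator norm. Glauber dynamics: for a probability measure $\nu$ on $\{-1,1\}^n$, $P^{\mathrm{GD}}(\nu)$ is the Markov kernel on the support of $\nu$ with $P^{\mathrm{GD}}_{x\to y}(\nu)=\frac1n\frac{\nu(y)}{\nu(x)+\nu(y)}$ if $x,y$ differ in exactly one coordinate, $P^{\mathrm{GD}}_{x\to x}(\nu)=\frac1n\sum_{i=1}^n\frac{\nu(x)}{\nu(x)+\nu(x\oplus e_i)}$ where $x\oplus e_i$ is $x$ with coordinate $i$ flipped, and $0$ otherwise. Mixing time: $t_{\mathrm{mix}}(P,\varepsilon)=\max_{x}\min\{t>0:\ |P^t[\delta_x](A)-\nu(A)|\le\varepsilon\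 \forall A\}$, $t$ ranging over positive integers and $P^t[\delta_x]$ being the law after $t$ steps from $x$. *)

(* Defs.v *)
From mathcomp Require Import all_boot all_order all_algebra.
From mathcomp Require Import boolp classical_sets reals constructive_ereal ereal.
From mathcomp Require Import sequences exp.

Set Implicit Arguments.
Unset Strict Implicit.
Unset Printing Implicit Defensive.

Import Order.TTheory GRing.Theory Num.Theory.

Local Open Scope ring_scope.

Definition dotp (R : realType) (n : nat) (x y : 'cV[R]_n) : R :=
  \sum_(i < n) x i 0 * y i 0.

(* The norm that MathComp-Analysis puts on matrices is the sup norm. *)
Definition norm2 (R : realType) (n : nat) (x : 'cV[R]_n) : R :=
  Num.sqrt (dotp x x).

Definition opnorm (R : realType) (n : nat) (J : 'M[R]_n) : R :=
  sup [set norm2 (J *m x) | x in [set x : 'cV[R]_n | norm2 x <= 1]]%classic.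

Definition posdefmx (R : realType) (n : nat) (J : 'M[R]_n) : Prop :=
  J^T = J /\ forall x : 'cV[R]_n, x != 0 -> 0 < dotp x (J *m x).

(* The hypercube {-1,1}^n is encoded by its sign bits: the [i]-th coordinate of
   [x] is [(-1) ^+ x i], so [true] stands for -1 and [false] for 1. *)
Definition cube (n : nat) : finType := {ffun 'I_n -> bool}.

Definition spins (R : realType) (n : nat) (x : cube n) : 'cV[R]_n :=
  \col_(i < n) (-1) ^+ (x i).

Definition flip (n : nat) (i : 'I_n) (x : cube n) : cube n :=
  [ffun j => if j == i then ~~ x j else x j].

Definition differ (n : nat) (x y : cube n) : {set 'I_n} :=
  [set i | x i != y i].

Definition ising_weight (R : realType) (n : nat) (J : 'M[R]_n) (v : 'cV[R]_n)
    (x : cube n) : R :=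
  expR (dotp (spins R x) (J *m spins R x) + dotp (spins R x) v).

(* A measure on a finite type is given by its point masses. *)
Definition ising (R : realType) (n : nat) (J : 'M[R]_n) (v : 'cV[R]_n)
    (x : cube n) : R :=
  ising_weight J v x / \sum_(y : cube n) ising_weight J v y.

(* Only meaningful from a state [x] of the support of [nu]; such a state has
   transition probability 0 to every state outside the support. *)
Definition glauber (R : realType) (n : nat) (nu : cube n -> R)
    (x y : cube n) : R :=
  if #|differ x y| == 1%N then n%:R^-1 * (nu y / (nu x + nu y))
  else if y == x then
    n%:R^-1 * \sum_(i < n) (nu x / (nu x + nu (flip i x)))
  else 0.

Definition dirac_mass (R : realType) (T : finType) (x y : T) : R :=
  (y == x)%:R.

Definition kernel_step (R : realType) (T : finType) (P : T -> T -> R)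
    (mu : T -> R) (y : T) : R :=
  \sum_(x : T) mu x * P x y.

Definition kernel_law (R : realType) (T : finType) (P : T -> T -> R) (t : nat)
    (x : T) : T -> R :=
  iter t (kernel_step P) (dirac_mass R x).

Definition mass (R : realType) (T : finType) (mu : T -> R) (A : {set T}) : R :=
  \sum_(y in A) mu y.

Definition mixed_from (R : realType) (T : finType) (P : T -> T -> R)
    (nu : T -> R) (eps : R) (x : T) (t : nat) : Prop :=
  forall A : {set T}, `|mass (kernel_law P t x) A - mass nu A| <= eps.

(* Valued in [\bar R]: the minimum over [t] is [+oo] when no [t] qualifies.
   The starting state ranges over the support of [nu]. *)
Definition tmix (R : realType) (T : finType) (P : T -> T -> R) (nu : T -> R)
    (eps : R) : \bar R :=
  \big[maxe/-oo%E]_(x : T | nu x != 0)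
    ereal_inf [set (t%:R%:E : \bar R) |
                 t in [set t : nat | (0 < t)%N /\ mixed_from P nu eps x t]]%classic.

(* Main.v *)
Require Import Defs.
From mathcomp Require Import boolp classical_sets reals constructive_ereal ereal.
From mathcomp Require Import topology normedtype derive realfun sequences exp.
From mathcomp Require Import all_boot all_order all_algebra.
From mathcomp Require Import ring lra.

Set Implicit Arguments.
Unset Strict Implicit.
Unset Printing Implicit Defensive.

Import Order.TTheory GRing.Theory Num.Theory.
Import numFieldNormedType.Exports.

Local Open Scope ring_scope.

(** The Glauber dynamics contracts relative entropy, at a rate that does not
    depend on the dimension, once entropy approximately tensorizes:
    [Ent f <= C * sum_i E (Ent_i f)], where [Ent_i] is the entropy in the
    [i]-th coordinate given the others ([approx_tensorization]).  Resampling
    coordinate [i] lowers the entropy of a density by exactly its [i]-th local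
    entropy, and a Glauber step is the average of the [n] resamplings, so that a
    step multiplies the entropy by at most [1 - 1 / (C n)]
    ([ent_step_contract]).  If the entropy is initially polynomial in [n], then
    [O(n log n)] steps make it small, and Pinsker's inequality
    ([mass_dev_le]) concludes.

    Tensorization with a constant depending on [q] only
    ([ising_weight_tensorization]) is obtained by a localization argument in
    discrete time.  Write [<t, J t>] as a sum of squares [<w_k, t>^2] and let
    [xi_s] range over the vectors [+- gamma w_k], with [gamma] of order
    [N^(-1/2)].  For a suitable [gamma] the [N]-th power of
    [c x = sum_s exp <xi_s, x>] is [exp <x, J x>] up to normalization and a
    factor between [1/e] and [e].  The weights [c^j * exp <p, x>] interpolate
    between a product measure ([j = 0]), for which the claim holds with constant
    [1], and the Ising measure ([j = N]).  Since
    [c^(j+1) * exp <p, x> = sum_s c^j * exp <p + xi_s, x>], each level is a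
    mixture of measures of the previous level with shifted fields, and two
    quantities are followed along the levels, uniformly in the field.

    - Covariance.  Let [k_j] bound the variance of [<t, x>] by [k_j |t|^2].  The
      law of total variance, with a first order expansion of the means of the
      components of the mixture, gives
      [k_(j+1) <= k_j + (2 q / N) k_j^2 + O(N^(-3/2))].  This is a discrete
      Riccati inequality whose solution stays bounded over [N] steps because
      [2 q < 1]; the gap between [2 q] and [1] absorbs the error terms
      ([cov_bound_level]).

    - Entropy.  A covariance bound valid for all fields implies the transport
      inequality [|b(mu) - b(nu)|^2 <= 2 k KL(mu | nu)] for the barycenters [b]
      ([cov_sqr_le_ent]).  Hence the entropy carried by the mixture index [s] is
      at most a fraction [O(1 / N)] of the whole ([ent_step]).  The local
      entropies do not increase on average when passing to the components
      ([local_ent_mix]), so that the tensorization constant is multiplied by at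
      most [1 / (1 - O(1 / N))] per level, and stays bounded
      ([tensorization_level]).

    The external field is arbitrary, so the stationary mass of a starting state
    has no lower bound in terms of [n] and the entropy of a point mass is not
    polynomial in [n].  But once every coordinate has been refreshed, the law of
    the chain has density at most [exp (n^2 + n)] with respect to the stationary
    law: the interaction changes any conditional probability by a factor at most
    [exp n].  By the coupon collector estimate the event that some coordinate
    has not been refreshed is negligible after [O(n log n)] steps, and the
    entropy argument is applied to the complementary part of the law
    ([kernel_law_mixing]). *)

(** * Elementary inequalities *)

Section ElementaryInequalities.
Variable R : realType.

Lemma ln_le_sub1 (x : R) : 0 < x -> ln x <= x - 1.
Proof.
move=> x0; have := @le_ln1Dx R (x - 1).
by rewrite subrKC; apply; rewrite ltrBDr addNr.
Qed.

Lemma ln_divE (x y : R) : 0 < x -> 0 < y -> ln (x / y) = ln x - ln y.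
Proof. by move=> x0 y0; rewrite ln_div ?posrE. Qed.

Lemma mul_ln_div_ge (a b : R) : 0 < a -> 0 < b -> a - b <= a * ln (a / b).
Proof.
move=> a0 b0; have := ln_le_sub1 (divr_gt0 b0 a0).
rewrite -[b / a]invf_div lnV ?posrE ?divr_gt0 // => h.
rewrite (_ : a - b = - (a * ((a / b)^-1 - 1))); last by field; rewrite !gt_eqF.
by rewrite lerNl -mulrN ler_pM2l.
Qed.

Lemma expR_le_inv (y : R) : y < 1 -> expR y <= (1 - y)^-1.
Proof.
move=> y1; rewrite -[y]opprK expRN opprK lef_pV2 ?posrE ?expR_gt0 ?subr_gt0 //.
exact: expR_ge1Dx.
Qed.

(** The error term is one-sided: the lower bound is the tangent line. *)
Lemma expR_taylor1 (y rho : R) : `|y| <= rho -> rho <= 1 / 2 ->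
  0 <= expR y - (1 + y) <= 2 * rho ^+ 2.
Proof.
rewrite ler_norml => /andP[y1 y2] rho2; rewrite subr_ge0 expR_ge1Dx /=.
have y_lt1 : y < 1 by lra.
have := expR_le_inv y_lt1.
rewrite -[X in _ <= X]mul1r ler_pdivlMr ?subr_gt0 // => h.
have : y ^+ 2 <= rho ^+ 2 by nra.
have := expR_gt0 y; nra.
Qed.

Lemma sqr_le_norm (a b : R) : `|a| <= b -> a ^+ 2 <= b ^+ 2.
Proof.
rewrite ler_norml => /andP[h1 h2]; rewrite -subr_ge0 subr_sqr mulr_ge0 //; lra.
Qed.

Lemma sqrD_weighted (rho a b : R) : 0 < rho ->
  (a + b) ^+ 2 <= (1 + rho) * a ^+ 2 + (1 + rho^-1) * b ^+ 2.
Proof.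
move=> r0; rewrite -subr_ge0.
rewrite (_ : _ - _ = (rho * a - b) ^+ 2 / rho); last by field; rewrite gt_eqF.
by rewrite divr_ge0 ?sqr_ge0 // ltW.
Qed.

Lemma sqrD_le2 (a b : R) : (a + b) ^+ 2 <= 2 * (a ^+ 2 + b ^+ 2).
Proof. have := sqr_ge0 (a - b); nra. Qed.

(** Since [exp y + exp (-y) - 2] is the square of [exp z - exp (-z)] with
    [z = y / 2], first order bounds on [exp z] give second order bounds here. *)
Lemma cosh_taylor (y rho : R) : `|y| <= rho -> rho <= 1 / 2 ->
  y ^+ 2 * (1 - rho) <= expR y + expR (- y) - 2 <= y ^+ 2 * (1 + 2 * rho).
Proof.
wlog y0 : y / 0 <= y => [W|].
  have [y0|y0] := leP 0 y; first exact: W.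
  move=> h1 h2; have := W (- y); rewrite normrN opprK sqrrN => /(_ _ h1 h2).
  by rewrite [expR (- y) + _]addrC; apply; rewrite oppr_ge0 ltW.
rewrite ger0_norm // => yr r2.
pose z := y / 2; have yE : y = z + z by rewrite /z; field.
have z0 : 0 <= z by rewrite /z divr_ge0.
have z2 : z <= 1 / 4 by lra.
have E0 := expR_gt0 z; have E1 := expR_ge1Dx z; have E2 := expR_ge1Dx (- z).
rewrite yE opprD !expRD; move: E2; rewrite !expRN; set E := expR z in E0 E1 *.
set F := E^-1 => F1; have EF : E * F = 1 by rewrite divff // gt_eqF.
have F0 : 0 < F by rewrite invr_gt0.
have F2 : F * (1 + z) <= 1 by nra.
have E3 : E * (1 - z) <= 1 by nra.
have F3 : F <= 1 - z + z ^+ 2 by nra.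
have E4 : E <= 1 + z + 2 * z ^+ 2 by nra.
have D1 : 2 * z - z ^+ 2 <= E - F by lra.
have D2 : E - F <= 2 * z + 2 * z ^+ 2 by lra.
have D0 : 0 <= 2 * z - z ^+ 2 by nra.
have -> : E * E + F * F - 2 = (E - F) ^+ 2 by rewrite -EF; ring.
have L : (2 * z - z ^+ 2) ^+ 2 <= (E - F) ^+ 2 by rewrite ler_pXn2r ?nnegrE //; lra.
have U : (E - F) ^+ 2 <= (2 * z + 2 * z ^+ 2) ^+ 2 by rewrite ler_pXn2r ?nnegrE //; lra.
have zz : 0 <= z ^+ 2 by exact: sqr_ge0.
apply/andP; split.
  apply: le_trans L; rewrite -subr_ge0.
  rewrite (_ : _ - _ = z ^+ 2 * (4 * (rho - z) + z ^+ 2)); last by ring.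
  by rewrite mulr_ge0 //; lra.
apply: le_trans U _; rewrite -subr_ge0.
rewrite (_ : _ - _ = z ^+ 2 * (8 * (rho - z) - 4 * z ^+ 2)); last by ring.
by rewrite mulr_ge0 //; nra.
Qed.

Lemma expR_le1D (z : R) : 0 <= z -> z <= 1 -> expR (z - z ^+ 2) <= 1 + z.
Proof.
move=> z0 z1; have h : z - z ^+ 2 < 1 by nra.
apply: le_trans (expR_le_inv h) _.
have h' : 0 < 1 - (z - z ^+ 2) by lra.
rewrite -[X in X <= _]mul1r ler_pdivrMr //.
by have : 0 <= z ^+ 3 by [exact: exprn_ge0]; lra.
Qed.

End ElementaryInequalities.

(** * Weighted averages on a finite set *)

Section Averages.
Variables (R : realType) (T : finType).
Implicit Types (W f g h a b : T -> R).

Definition positive W := forall x, 0 < W x.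

Definition tot W : R := \sum_x W x.

Definition avg W g : R := (\sum_x W x * g x) / tot W.

Definition cov W f g : R := avg W (fun x => f x * g x) - avg W f * avg W g.

Definition ent W f : R := avg W (fun x => f x * ln (f x / avg W f)).

Lemma eq_avg W f g : f =1 g -> avg W f = avg W g.
Proof. by move=> e; congr (_ / _); apply: eq_bigr => x _; rewrite e. Qed.

Lemma eq_cov W f g f' g' : f =1 f' -> g =1 g' -> cov W f g = cov W f' g'.
Proof.
move=> ef eg; rewrite /cov (eq_avg _ ef) (eq_avg _ eg).
by congr (_ - _); apply: eq_avg => x; rewrite ef eg.
Qed.

Lemma avgD W f g : avg W (fun x => f x + g x) = avg W f + avg W g.
Proof.
rewrite /avg -mulrDl -big_split /=; congr (_ / _).
by apply: eq_bigr => x _; rewrite mulrDr.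
Qed.

Lemma avgZ W c f : avg W (fun x => c * f x) = c * avg W f.
Proof.
rewrite /avg mulrA mulr_sumr; congr (_ / _).
by apply: eq_bigr => x _; rewrite mulrCA.
Qed.

Lemma avgB W f g : avg W (fun x => f x - g x) = avg W f - avg W g.
Proof.
rewrite -[- avg W g]mulN1r -avgZ -avgD; apply: eq_avg => x.
by rewrite mulN1r.
Qed.

Lemma avg_sum (I : finType) W (F : I -> T -> R) :
  avg W (fun x => \sum_i F i x) = \sum_i avg W (F i).
Proof.
rewrite /avg -mulr_suml exchange_big /=; congr (_ / _).
by apply: eq_bigr => x _; rewrite mulr_sumr.
Qed.

Lemma avg_scale W c f : c != 0 -> avg (fun x => c * W x) f = avg W f.
Proof.
move=> c0; rewrite /avg /tot -mulr_sumr invfM mulrA; congr (_ / _).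
under eq_bigr do rewrite -mulrA.
by rewrite -mulr_sumr mulrAC divff // mul1r.
Qed.

Lemma covC W f g : cov W f g = cov W g f.
Proof.
by rewrite /cov mulrC; congr (_ - _); apply: eq_avg => x; rewrite mulrC.
Qed.

Lemma covDr W f g h : cov W f (fun x => g x + h x) = cov W f g + cov W f h.
Proof.
rewrite /cov (eq_avg _ (fun x => mulrDr (f x) (g x) (h x))) !avgD; ring.
Qed.

Lemma covZr W c f g : cov W f (fun x => c * g x) = c * cov W f g.
Proof.
rewrite /cov (eq_avg _ (fun x => mulrCA (f x) c (g x))) !avgZ; ring.
Qed.

Lemma covDl W f g h : cov W (fun x => f x + g x) h = cov W f h + cov W g h.
Proof. by rewrite covC covDr !(covC W h). Qed.

Lemma covZl W c f g : cov W (fun x => c * f x) g = c * cov W f g.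
Proof. by rewrite covC covZr covC. Qed.

Lemma cov_sumr (I : finType) W f (F : I -> T -> R) :
  cov W f (fun x => \sum_i F i x) = \sum_i cov W f (F i).
Proof.
rewrite /cov avg_sum (eq_avg _ (fun x => mulr_sumr _ _ _ (f x))) avg_sum.
by rewrite mulr_sumr -sumrB.
Qed.

Section Positive.
Variables (x0 : T) (W : T -> R).
Hypothesis W_gt0 : positive W.

Lemma tot_gt0 : 0 < tot W.
Proof.
rewrite /tot (bigD1 x0) //= ltr_pwDl ?sumr_ge0 // => x _; exact: ltW.
Qed.

Lemma tot_neq0 : tot W != 0. Proof. by rewrite gt_eqF // tot_gt0. Qed.

Lemma avg_cst c : avg W (fun=> c) = c.
Proof. by rewrite /avg -mulr_suml -mulrA mulrCA divff ?mulr1 ?tot_neq0. Qed.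

Lemma tot_avg g : tot W * avg W g = \sum_x W x * g x.
Proof. by rewrite mulrC divfK // tot_neq0. Qed.

Lemma avg_ge0 g : (forall x, 0 <= g x) -> 0 <= avg W g.
Proof.
move=> g0; rewrite divr_ge0 ?(ltW tot_gt0) // sumr_ge0 // => x _.
by rewrite mulr_ge0 // ltW.
Qed.

Lemma ler_avg f g : (forall x, f x <= g x) -> avg W f <= avg W g.
Proof. by move=> fg; rewrite -subr_ge0 -avgB avg_ge0 // => x; rewrite subr_ge0. Qed.

Lemma avg_gt0 g : (forall x, 0 < g x) -> 0 < avg W g.
Proof.
move=> g0; rewrite divr_gt0 ?tot_gt0 // (bigD1 x0) //=.
by rewrite ltr_pwDl ?mulr_gt0 // sumr_ge0 // => x _; rewrite ltW // mulr_gt0.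
Qed.

Lemma cov_cstr f c : cov W f (fun=> c) = 0.
Proof.
rewrite /cov avg_cst (eq_avg _ (fun x => mulrC (f x) c)) avgZ; ring.
Qed.

Lemma avg_sqr_center g c :
  avg W (fun x => (g x - c) ^+ 2) = cov W g g + (avg W g - c) ^+ 2.
Proof.
rewrite (eq_avg _ (g := fun x => g x * g x + ((- (2 * c)) * g x + c ^+ 2))).
  rewrite avgD avgD avgZ avg_cst /cov; ring.
by move=> x; ring.
Qed.

Lemma var_ge0 g : 0 <= cov W g g.
Proof.
have := avg_sqr_center g (avg W g); rewrite subrr expr0n addr0 => <-.
by apply: avg_ge0 => x; exact: sqr_ge0.
Qed.

Lemma var_le_sqr_center g c : cov W g g <= avg W (fun x => (g x - c) ^+ 2).
Proof. by rewrite avg_sqr_center lerDl sqr_ge0. Qed.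

Lemma cov_le_sqr f g : cov W f g ^+ 2 <= cov W f f * cov W g g.
Proof.
have q (s : R) : 0 <= cov W f f + (2 * s) * cov W f g + s ^+ 2 * cov W g g.
  have := var_ge0 (fun x => f x + s * g x).
  rewrite covDl !covDr !covZl !covZr (covC W g f); congr (_ <= _); ring.
have := var_ge0 g; rewrite le_eqVlt => /orP[/eqP g0|g0].
  have [->|fg] := eqVneq (cov W f g) 0; first by rewrite -g0 expr0n mulr0.
  (* when [g] has variance zero the polynomial is affine in [s]: a value of [s]
     where it is [-1] is a contradiction *)
  have := q (- (cov W f f + 1) / (2 * cov W f g)).
  rewrite -g0 mulr0 addr0 (_ : 2 * _ * _ = - (cov W f f + 1)); last by field.
  by lra.
have := q (- cov W f g / cov W g g).
rewrite (_ : _ + _ = (cov W f f * cov W g g - cov W f g ^+ 2) / cov W g g).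
  by rewrite pmulr_lge0 ?invr_gt0 // subr_ge0.
by field; rewrite gt_eqF.
Qed.

End Positive.

End Averages.

(** * From covariances of tilted measures to a transport inequality *)

Section Subgaussian.
Variables (R : realType) (T : finType).

Lemma is_derive_sum_fin (h : T -> R -> R) (dh : T -> R) (u : R) :
  (forall x, is_derive u 1 (h x) (dh x)) ->
  is_derive u 1 (fun v => \sum_x h x v) (\sum_x dh x).
Proof.
move=> H; rewrite unlock /=; elim: (index_enum T) => [|x s IH] /=.
  exact: is_derive_cst.
by apply: is_deriveD.
Qed.

Implicit Types (W a g f : T -> R) (u v V : R).

Definition tilt (W a : T -> R) (u : R) (x : T) : R := W x * expR (u * a x).

Lemma tilt_gt0 W a u : positive W -> positive (tilt W a u).
Proof. by move=> W0 x; rewrite mulr_gt0 ?expR_gt0. Qed.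

Lemma tilt0 W a x : tilt W a 0 x = W x.
Proof. by rewrite /tilt mul0r expR0 mulr1. Qed.

Lemma is_derive_tilt W a g u : is_derive u (1 : R) (fun v => \sum_x tilt W a v x * g x)
    (\sum_x tilt W a u x * (a x * g x)).
Proof.
apply: is_derive_sum_fin => x.
rewrite (_ : (fun v => tilt W a v x * g x) =
  (fun v => (W x * g x) *: (expR (v * a x)))); last first.
  by apply/funext => v; rewrite /tilt /GRing.scale /=; ring.
have -> : tilt W a u x * (a x * g x) = (W x * g x) *: (expR (u * a x) * a x).
  by rewrite /tilt /GRing.scale /=; ring.
apply: is_deriveZ; apply: (@is_derive1_comp _ expR (fun v => v * a x)).
rewrite (_ : (fun v => v * a x) = (a x) \*: (@id R)); last first.
  by apply/funext => v; rewrite /= /GRing.scale /= mulrC.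
rewrite -[X in is_derive _ _ _ X](mulr1 (a x)).
exact: is_deriveZ.
Qed.

(** The derivative of the mean along a tilt is the variance. *)
Lemma is_derive_tilt_avg (x0 : T) W a u : positive W ->
  is_derive u 1 (fun v => avg (tilt W a v) a) (cov (tilt W a u) a a).
Proof.
move=> W0; have t0 v := tot_neq0 x0 (tilt_gt0 a v W0).
have D1 := is_derive_tilt W a a u.
have D0 : is_derive u 1 (fun v => tot (tilt W a v)) (\sum_x tilt W a u x * a x).
  rewrite (_ : (fun v => tot _) = (fun v => \sum_x tilt W a v x * 1)).
    have -> : \sum_x tilt W a u x * a x = \sum_x tilt W a u x * (a x * 1).
      by apply: eq_bigr => x _; rewrite mulr1.
    exact: is_derive_tilt.
  by apply/funext => v; apply: eq_bigr => x _; rewrite mulr1.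
apply: (is_derive_eq (is_deriveM D1 (is_deriveV (t0 u) D0))).
by rewrite /cov /avg /GRing.scale /=; field; exact: t0.
Qed.

Lemma ler0_is_derive (f df : R -> R) :
  (forall u, is_derive u 1 f (df u)) -> (forall u, 0 <= u -> df u <= 0) ->
  forall u, 0 <= u -> f u <= f 0.
Proof.
move=> D le0 u u0.
apply: (@ler0_derive1_le_cc _ f 0 u) => [v|v||||]; rewrite ?in_itv /= ?lexx ?u0 //.
- move=> /andP[v0 _].
  by rewrite derive1E; have [_ ->] := D v; exact/le0/ltW.
- apply: continuous_subspaceT => v.
  by apply: differentiable_continuous; apply/derivable1_diffP; have [] := D v.
Qed.

Lemma is_derive_quadratic (A V w : R) :
  is_derive w 1 (fun v : R => v * A + v ^+ 2 / 2 * V) (A + w * V).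
Proof.
have d1 : is_derive w 1 (fun v : R => A *: v) (A *: 1) by exact: is_deriveZ.
have d2 : is_derive w 1 (fun v : R => v * v) (w *: 1 + w *: 1).
  exact: (is_deriveM (is_derive_id w 1) (is_derive_id w 1)).
have d3 : is_derive w 1 (fun v : R => (V / 2) *: (v * v)) ((V / 2) *: (w *: 1 + w *: 1)).
  exact: is_deriveZ.
have -> : (fun v : R => v * A + v ^+ 2 / 2 * V) =
    (fun v : R => A * v) \+ (fun v : R => (V / 2) * (v * v)).
  by apply/funext => v /=; field.
apply: (is_derive_eq (is_deriveD d1 d3)).
by rewrite /GRing.scale /=; field.
Qed.

(** The second derivative of the cumulant generating function of [a] at [u]
    is the variance of [a] under the tilt by [u], so that two integrations from
    [0] give a subgaussian bound. *)
Lemma avg_expR_le (x0 : T) W a V : positive W ->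
    (forall u, cov (tilt W a u) a a <= V) ->
  forall u, 0 <= u ->
    avg W (fun x => expR (u * a x)) <= expR (u * avg W a + u ^+ 2 / 2 * V).
Proof.
move=> W0 hV u u0.
have tp v := tilt_gt0 a v W0; have t0 v := tot_gt0 x0 (tp v).
have W0E : tilt W a 0 = W by apply/funext => x; rewrite tilt0.
have mean v : 0 <= v -> avg (tilt W a v) a <= avg W a + v * V.
  pose f v := avg (tilt W a v) a - v * V.
  have D (w : R) : is_derive w 1 f (cov (tilt W a w) a a - V).
    apply: is_deriveB; first exact: is_derive_tilt_avg.
    rewrite (_ : (fun v => v * V) = V \*: (@id R)); last first.
      by apply/funext => z; rewrite /= /GRing.scale /= mulrC.
    rewrite -[X in is_derive _ _ _ X](mulr1 V); exact: is_deriveZ.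
  move=> v0; have D_le0 w : 0 <= w -> cov (tilt W a w) a a - V <= 0.
    by rewrite subr_le0.
  by have := ler0_is_derive D D_le0 v0; rewrite /f W0E mul0r subr0 lerBlDr.
pose k v := ln (tot (tilt W a v)) - (v * avg W a + v ^+ 2 / 2 * V).
have D (w : R) : is_derive w 1 k (avg (tilt W a w) a - (avg W a + w * V)).
  apply: is_deriveB.
    have -> : avg (tilt W a w) a =
      (tot (tilt W a w))^-1 * (\sum_x tilt W a w x * (a x * 1)).
      rewrite /avg mulrC; congr (_ * _).
      by apply: eq_bigr => x _; rewrite mulr1.
    apply: (@is_derive1_comp _ (@ln R) (fun v => tot (tilt W a v))).
      exact: is_derive1_ln.
    rewrite (_ : (fun v => tot _) = (fun v => \sum_x tilt W a v x * 1)).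
      exact: is_derive_tilt.
    by apply/funext => v; apply: eq_bigr => x _; rewrite mulr1.
  exact: is_derive_quadratic.
have D_le0 w : 0 <= w -> avg (tilt W a w) a - (avg W a + w * V) <= 0.
  by move=> w0; rewrite subr_le0 mean.
have := ler0_is_derive D D_le0 u0.
rewrite /k W0E mul0r expr0n mul0r mul0r addr0 subr0 lerBlDr => h.
have totW := tot_gt0 x0 W0.
rewrite /avg ler_pdivrMr // -[X in X <= _]/(tot (tilt W a u)).
rewrite -ler_ln ?posrE ?mulr_gt0 ?expR_gt0 //.
by rewrite lnM ?posrE ?expR_gt0 // expRK addrC addrC [X in _ <= X]addrC.
Qed.

(** The Gibbs variational principle bounds [cov f (u * a) - log E exp (u * a)]
    by the entropy, and the second term is at most quadratic in [u] by
    [avg_expR_le]; the claim is the optimum in [u].  When [f] is the density of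
    [mu] with respect to [nu], this reads
    [(mu a - nu a)^2 <= 2 V * KL(mu | nu)].  Both the transport inequality for
    barycenters and Pinsker's inequality are instances. *)
Lemma cov_sqr_le_ent (x0 : T) W a V f : positive W -> 0 < V ->
    (forall u, cov (tilt W a u) a a <= V) -> positive f ->
  cov W f a ^+ 2 <= 2 * V * (avg W f * ent W f).
Proof.
move=> W0 V0 hV f0.
have F0 : 0 < avg W f by apply: avg_gt0.
have gibbs (b : T -> R) L : avg W (fun x => expR (b x)) <= expR L ->
    avg W (fun x => f x * b x) - avg W f * L <= ent W f.
  move=> hb.
  have : avg W (fun x => f x * (b x - L) + f x - avg W f * (expR (b x) * expR (- L)))
       <= ent W f.
    apply: ler_avg => // x.
    have /= := mul_ln_div_ge (f0 x) (mulr_gt0 F0 (expR_gt0 (b x - L))).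
    have -> : ln (f x / (avg W f * expR (b x - L))) =
        ln (f x / avg W f) - (b x - L).
      by rewrite invfM mulrA (ln_divE (divr_gt0 (f0 x) F0) (expR_gt0 _)) expRK.
    rewrite expRD; lra.
  rewrite avgB avgD avgZ.
  rewrite (eq_avg _ (fun x => mulrC (expR (b x)) _)) avgZ.
  rewrite (eq_avg _ (fun x => mulrBr (f x) (b x) L)) avgB.
  rewrite (eq_avg _ (fun x => mulrC (f x) L)) avgZ.
  have : expR (- L) * avg W (fun x => expR (b x)) <= 1.
    by rewrite expRN mulrC ler_pdivrMr ?expR_gt0 // mul1r.
  by move=> /(ler_wpM2l (ltW F0)); lra.
have one (b : T -> R) s : (forall u, cov (tilt W b u) b b <= V) -> 0 <= s ->
    s * cov W f b - avg W f * (s ^+ 2 / 2 * V) <= ent W f.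
  move=> hb s0; have := gibbs _ _ (avg_expR_le x0 W0 hb s0).
  rewrite (eq_avg _ (fun x => mulrCA (f x) s (b x))) avgZ /cov; lra.
have opt (b : T -> R) : (forall u, cov (tilt W b u) b b <= V) ->
    0 <= cov W f b -> cov W f b ^+ 2 <= 2 * V * (avg W f * ent W f).
  move=> hb c0; have FV : 0 < avg W f * V by rewrite mulr_gt0.
  (* the optimal tilt *)
  have := one b _ hb (divr_ge0 c0 (ltW FV)).
  rewrite (_ : _ - _ = cov W f b ^+ 2 / (2 * V * avg W f)).
    have VF : 0 < 2 * V * avg W f by rewrite -mulrA (mulrC V) mulr_gt0.
    by rewrite ler_pdivrMr // mulrC mulrA.
  by field; rewrite !gt_eqF.
have [c0|c0] := leP 0 (cov W f a); first exact: opt.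
rewrite -sqrrN -mulN1r -covZr; apply: opt; last by rewrite covZr; lra.
move=> u; rewrite covZl covZr !mulN1r opprK.
rewrite (_ : tilt _ _ _ = tilt W a (- u)) //.
by apply/funext => x; rewrite /tilt mulN1r mulrN mulNr.
Qed.

End Subgaussian.

(** * Mixtures of small exponential tilts *)

Section Mixtures.
Variables (R : realType) (T S : finType) (x0 : T).
Implicit Types (f g : T -> R).

Definition mix (Ws : S -> T -> R) (x : T) : R := \sum_s Ws s x.

Definition mix_prob (Ws : S -> T -> R) (s : S) : R :=
  tot (Ws s) / tot (mix Ws).

Section PositiveMixture.
Variables (s0 : S) (Ws : S -> T -> R).
Hypothesis Ws_gt0 : forall s, positive (Ws s).

Lemma mix_gt0 : positive (mix Ws).
Proof.
move=> x; rewrite /mix (bigD1 s0) //= ltr_pwDl ?Ws_gt0 // sumr_ge0 // => s _.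
exact/ltW/Ws_gt0.
Qed.

Lemma mix_prob_gt0 s : 0 < mix_prob Ws s.
Proof. by rewrite divr_gt0 ?(tot_gt0 x0) //; exact: mix_gt0. Qed.

Lemma tot_mix : tot (mix Ws) = \sum_s tot (Ws s).
Proof. by rewrite /tot exchange_big. Qed.

Lemma sum_mix_prob : \sum_s mix_prob Ws s = 1.
Proof.
rewrite /mix_prob -mulr_suml -tot_mix divff // (tot_neq0 x0) //.
exact: mix_gt0.
Qed.

Lemma avg_mix g : avg (mix Ws) g = \sum_s mix_prob Ws s * avg (Ws s) g.
Proof.
have t0 s : tot (Ws s) != 0 by exact: tot_neq0.
rewrite [LHS]/avg; under eq_bigr do rewrite mulr_suml.
rewrite exchange_big mulr_suml; apply: eq_bigr => s _.
rewrite /mix_prob /avg; field; rewrite t0 (tot_neq0 x0) //; exact: mix_gt0.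
Qed.

Lemma mix_prob_avg s g :
  mix_prob Ws s * avg (Ws s) g = avg (mix Ws) (fun x => g x * (Ws s x / mix Ws x)).
Proof.
have t0 : tot (Ws s) != 0 by exact: tot_neq0.
have -> : mix_prob Ws s * avg (Ws s) g = (\sum_x Ws s x * g x) / tot (mix Ws).
  by rewrite /mix_prob /avg; field; rewrite t0 (tot_neq0 x0) //; exact: mix_gt0.
congr (_ / _); apply: eq_bigr => x _; field; rewrite gt_eqF //; exact: mix_gt0.
Qed.

Lemma mix_probE s :
  mix_prob Ws s = avg (mix Ws) (fun x => Ws s x / mix Ws x).
Proof.
rewrite -[LHS]mulr1 -(avg_cst x0 (Ws_gt0 s) 1) mix_prob_avg.
by apply: eq_avg => x; rewrite mul1r.
Qed.

(** The mean of a component deviates from the mean of the mixture by the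
    covariance with the posterior probability of that component. *)
Lemma mix_prob_dev s g :
  mix_prob Ws s * (avg (Ws s) g - avg (mix Ws) g) =
  cov (mix Ws) g (fun x => Ws s x / mix Ws x).
Proof.
by rewrite mulrBr mix_prob_avg /cov (mulrC (mix_prob _ _)) mix_probE.
Qed.

Lemma var_mix_le g c V : (forall s, cov (Ws s) g g <= V) ->
  cov (mix Ws) g g <= V + \sum_s mix_prob Ws s * (avg (Ws s) g - c) ^+ 2.
Proof.
move=> hV; apply: le_trans (var_le_sqr_center x0 mix_gt0 g c) _.
rewrite avg_mix -[X in X + _]mul1r -sum_mix_prob mulr_suml -big_split /=.
apply: ler_sum => s _; rewrite (avg_sqr_center x0 (Ws_gt0 s)) -mulrDr.
by rewrite ler_pM2l ?mix_prob_gt0 // lerD2r.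
Qed.

(** Chain rule for entropy: the entropy of a mixture is the average entropy
    of its components plus the entropy of the component means; the latter is
    bounded by its chi-square version. *)
Lemma ent_mix_le f : positive f ->
  ent (mix Ws) f <= \sum_s mix_prob Ws s * ent (Ws s) f +
    \sum_s cov (mix Ws) f (fun x => Ws s x / mix Ws x) ^+ 2
           / (mix_prob Ws s * avg (mix Ws) f).
Proof.
move=> f0; set F := avg (mix Ws) f.
have F0 : 0 < F by apply: (avg_gt0 x0) => //; exact: mix_gt0.
pose Fs s := avg (Ws s) f.
have Fs0 s : 0 < Fs s by exact: (avg_gt0 x0).
have p0 := mix_prob_gt0.
have sF : \sum_s mix_prob Ws s * Fs s = F by rewrite -avg_mix.
have -> : ent (mix Ws) f = \sum_s mix_prob Ws s * ent (Ws s) f +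
   \sum_s mix_prob Ws s * (Fs s * ln (Fs s / F)).
  rewrite /ent avg_mix -big_split /=; apply: eq_bigr => s _; rewrite -mulrDr.
  congr (_ * _); rewrite -/F -/(Fs s) (mulrC (Fs s)) -avgZ -avgD.
  apply: eq_avg => x.
  rewrite (ln_divE (f0 x) F0) (ln_divE (f0 x) (Fs0 s)) (ln_divE (Fs0 s) F0); ring.
rewrite lerD2l.
have -> : \sum_s cov (mix Ws) f (fun x => Ws s x / mix Ws x) ^+ 2
           / (mix_prob Ws s * F) =
    \sum_s mix_prob Ws s * (Fs s * (Fs s / F - 1)).
  under eq_bigr do rewrite -mix_prob_dev -/F -/(Fs _).
  have -> : \sum_s (mix_prob Ws s * (Fs s - F)) ^+ 2 / (mix_prob Ws s * F) =
     \sum_s (mix_prob Ws s * (Fs s * (Fs s / F - 1))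
        + (mix_prob Ws s * F - mix_prob Ws s * Fs s)).
    by apply: eq_bigr => s _; field; rewrite !gt_eqF.
  by rewrite big_split /= sumrB sF -mulr_suml sum_mix_prob mul1r subrr addr0.
apply: ler_sum => s _; rewrite !ler_pM2l //; apply: ln_le_sub1.
by rewrite divr_gt0.
Qed.

End PositiveMixture.

Definition reweight (W : T -> R) (y : S -> T -> R) s x := W x * expR (y s x).

Section SmallShifts.
Variables (s0 : S) (W : T -> R) (y : S -> T -> R) (rho : R).
Hypothesis W_gt0 : positive W.
Hypothesis y_sum0 : forall x, \sum_s y s x = 0.
Hypothesis rho_gt0 : 0 < rho.
Hypothesis y_le : forall s x, `|y s x| <= rho.

Let m : R := #|S|%:R.

Lemma card_index_gt0 : 0 < m.
Proof. by rewrite ltr0n; apply/card_gt0P; exists s0. Qed.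

Lemma reweight_gt0 s : positive (reweight W y s).
Proof. by move=> x; rewrite mulr_gt0 ?expR_gt0. Qed.

Lemma sum_cst_index (c : R) : \sum_(s : S) c = m * c.
Proof. by rewrite sumr_const mulr_natl cardE. Qed.

Lemma sum_1D x : \sum_s (1 + y s x) = m.
Proof. by rewrite big_split /= y_sum0 addr0 sum_cst_index mulr1. Qed.

(** One step of the Riccati inequality: here [A] bounds the averaged squared
    covariances of [g] with the exponents of the tilts.  By the law of total
    variance it suffices to bound the spread of the means of the components
    around [avg W g], and to first order in [y s] such a mean is displaced by
    [cov W g (y s)].  The factor of [A] tends to [1] with [rho], which is what
    allows all [q < 1 / 2] in the end. *)
Lemma var_step g V A : rho <= 1 / 2 ->
    (forall s, cov (reweight W y s) g g <= V) -> cov W g g <= V ->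
    \sum_s cov W g (y s) ^+ 2 <= m * A ->
  cov (mix (reweight W y)) g g <=
    V + ((1 + rho) * A + 8 * rho ^+ 3 * V) / (1 - rho).
Proof.
move=> rho2 hVs hV hA.
have m0 := card_index_gt0.
have V0 : 0 <= V by apply: le_trans hV; exact: (var_ge0 x0).
apply: le_trans (var_mix_le s0 reweight_gt0 (avg W g) hVs) _.
rewrite lerD2l.
pose E s := avg W (fun x => expR (y s x)).
have E0 s : 0 < E s by apply: (avg_gt0 x0) => // x; exact: expR_gt0.
have totE s : tot (reweight W y s) = tot W * E s by rewrite (tot_avg x0).
have tW := tot_neq0 x0 W_gt0.
have E_ge s : 1 - rho <= E s.
  rewrite -[1 - rho](avg_cst x0 W_gt0); apply: (ler_avg x0) => // x.
  by have := expR_ge1Dx (y s x); have := y_le s x; rewrite ler_norml; lra.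
have sE_ge : m <= \sum_s E s.
  rewrite -avg_sum -(avg_cst x0 W_gt0 m); apply: (ler_avg x0) => // x.
  by rewrite -(sum_1D x); apply: ler_sum => s _; exact: expR_ge1Dx.
have dev s : avg (reweight W y s) g - avg W g = cov W g (fun x => expR (y s x)) / E s.
  have -> : avg (reweight W y s) g = avg W (fun x => g x * expR (y s x)) / E s.
    rewrite {1}/avg totE /avg; under eq_bigr do rewrite -mulrA (mulrC (expR _)).
    by rewrite invfM mulrA.
  rewrite /cov -/(E s); field; exact: lt0r_neq0.
have -> : \sum_s mix_prob (reweight W y) s * (avg (reweight W y s) g - avg W g) ^+ 2 =
    \sum_s cov W g (fun x => expR (y s x)) ^+ 2 / (E s * \sum_s E s).
  apply: eq_bigr => s _; rewrite dev /mix_prob tot_mix totE.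
  under eq_bigr do rewrite totE.
  rewrite -mulr_sumr; field.
  by rewrite tW !gt_eqF // (lt_le_trans m0).
(* the weight [rho] in [(a + b)^2] balances the first order term, of order
   [rho], and the Taylor remainder, of order [rho^2] *)
pose D s := (1 + rho) * cov W g (y s) ^+ 2 + 8 * rho ^+ 3 * V.
apply: (@le_trans _ _ (\sum_s D s / ((1 - rho) * m))).
  apply: ler_sum => s _.
  have num : cov W g (fun x => expR (y s x)) ^+ 2 <= D s.
    pose r x := expR (y s x) - (1 + y s x).
    have -> : cov W g (fun x => expR (y s x)) = cov W g (y s) + cov W g r.
      rewrite (@eq_cov _ _ W g _ g (fun x => 1 + (y s x + r x))) //; last first.
        by move=> x; rewrite /r; ring.
      by rewrite covDr (cov_cstr x0 W_gt0) add0r covDr.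
    apply: le_trans (sqrD_weighted _ _ rho_gt0) _; rewrite lerD2l.
    have vr : cov W r r <= 4 * rho ^+ 4.
      apply: le_trans (var_le_sqr_center x0 W_gt0 r 0) _.
      rewrite -(avg_cst x0 W_gt0 (4 * _)); apply: (ler_avg x0) => // x.
      have /andP[r1 r2] := expR_taylor1 (y_le s x) rho2.
      by rewrite subr0 (_ : 4 * _ = (2 * rho ^+ 2) ^+ 2) ?ler_pXn2r ?nnegrE //;
         [rewrite mulr_ge0 // sqr_ge0 | ring].
    have cr : cov W g r ^+ 2 <= V * (4 * rho ^+ 4).
      apply: le_trans (cov_le_sqr x0 W_gt0 g r) _.
      by apply: ler_pM; rewrite // (var_ge0 x0).
    apply: (@le_trans _ _ ((1 + rho^-1) * (V * (4 * rho ^+ 4)))).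
      by rewrite ler_wpM2l // addr_ge0 // invr_ge0 ltW.
    rewrite (_ : (1 + _) * _ = 4 * V * rho ^+ 3 * (1 + rho)); last first.
      by field; rewrite gt_eqF.
    have : 0 <= 4 * V * rho ^+ 3 by rewrite !mulr_ge0 // ltW // exprn_gt0.
    by nra.
  apply: ler_pM => //; first exact: sqr_ge0.
    by rewrite invr_ge0 mulr_ge0 // ?ltW // (lt_le_trans m0).
  have r1 : 0 < 1 - rho by lra.
  have sE0 : 0 < \sum_s E s by exact: lt_le_trans sE_ge.
  rewrite lef_pV2; first by apply: ler_pM => //; exact: ltW.
    by rewrite posrE; exact: mulr_gt0 (E0 s) sE0.
  by rewrite posrE; exact: mulr_gt0 r1 m0.
have r1 : 0 < 1 - rho by lra.
rewrite -mulr_suml big_split /= -mulr_sumr sum_cst_index.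
rewrite ler_pdivrMr ?(mulr_gt0 r1) // (mulrA (_ / _)) divfK ?lt0r_neq0 //.
rewrite [X in _ <= X]mulrDl (mulrC m) lerD2r -mulrA ler_wpM2l //.
  by rewrite addr_ge0 // ltW.
by rewrite (mulrC A).
Qed.

(** The index of the mixture carries only a small part of the entropy:
    the posterior probability of [s] is [(1 + y s x) / m] up to a relative error
    [O(rho^2)].  The hypothesis controls the contribution of the first order
    term, and [cov_sqr_le_ent] for a bounded function that of the error. *)
Lemma ent_step f B : rho <= 1 / 4 -> positive f ->
    \sum_s cov (mix (reweight W y)) f (y s) ^+ 2 <=
      m * (B * (avg (mix (reweight W y)) f * ent (mix (reweight W y)) f)) ->
  ent (mix (reweight W y)) f <=
    \sum_s mix_prob (reweight W y) s * ent (reweight W y s) f +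
    4 * (B + 32 * rho ^+ 4) * ent (mix (reweight W y)) f.
Proof.
move=> rho4 f0; set W' := mix _; set F := avg W' f; set e := ent W' f => hB.
have m0 := card_index_gt0.
have W'0 : positive W' by apply: (mix_gt0 s0) => s; exact: reweight_gt0.
have F0 : 0 < F by exact: (avg_gt0 x0).
apply: le_trans (ent_mix_le s0 reweight_gt0 f0) _; rewrite lerD2l -/W' -/F.
have r0 := rho_gt0; have rho2 : rho <= 1 / 2 by lra.
pose c x := \sum_s expR (y s x).
have W'E x : W' x = W x * c x by rewrite mulr_sumr.
have c_bounds x : m <= c x <= m * (1 + 2 * rho ^+ 2).
  rewrite mulrDr mulr1 -sum_cst_index -(sum_1D x) -big_split /=.
  apply/andP; split; apply: ler_sum => s _; first exact: expR_ge1Dx.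
  by have /andP[] := expR_taylor1 (y_le s x) rho2; lra.
have c0 x : 0 < c x by have /andP[h _] := c_bounds x; apply: lt_le_trans h.
(* the remainder of the expansion of [m] times the posterior probability of
   [s] *)
pose q s x := m * (expR (y s x) / c x) - (1 + y s x).
have kE s x : reweight W y s x / W' x = m^-1 * (1 + (y s x + q s x)).
  rewrite W'E /reweight /q; field; rewrite !gt_eqF //.
have q_le s x : `|q s x| <= 4 * rho ^+ 2.
  have /andP[c1 c2] := c_bounds x.
  have /andP[e1 e2] := expR_taylor1 (y_le s x) rho2.
  have := y_le s x; rewrite ler_norml => /andP[y1 y2].
  have rr : 0 <= rho ^+ 2 by exact: sqr_ge0.
  have -> : q s x = (m * expR (y s x) - (1 + y s x) * c x) / c x.
    by rewrite /q; field; rewrite gt_eqF.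
  rewrite ler_norml; apply/andP; split.
    rewrite ler_pdivlMr //.
    have h1 : m * (1 + y s x) <= m * expR (y s x) by rewrite ler_pM2l //; lra.
    have h2 : (1 + y s x) * c x <= (1 + y s x) * (m * (1 + 2 * rho ^+ 2)).
      by rewrite ler_wpM2l //; lra.
    have h3 : (1 + y s x) * (m * (2 * rho ^+ 2)) <= 2 * (m * (2 * rho ^+ 2)).
      by rewrite ler_wpM2r ?mulr_ge0 ?ltW //; lra.
    have h4 : 4 * rho ^+ 2 * m <= 4 * rho ^+ 2 * c x by rewrite ler_wpM2l // mulr_ge0.
    by lra.
  rewrite ler_pdivrMr //.
  have h1 : m * expR (y s x) <= m * (1 + y s x + 2 * rho ^+ 2).
    by rewrite ler_pM2l //; lra.
  have h2 : (1 + y s x) * m <= (1 + y s x) * c x.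
    by rewrite ler_wpM2l //; lra.
  have h4 : 4 * rho ^+ 2 * m <= 4 * rho ^+ 2 * c x by rewrite ler_wpM2l // mulr_ge0.
  have h5 : 0 <= rho ^+ 2 * m by rewrite mulr_ge0 // ltW.
  by lra.
have p_ge s : (2 * m)^-1 <= mix_prob (reweight W y) s.
  rewrite (mix_probE s0 reweight_gt0) -/W' -(avg_cst x0 W'0 (2 * m)^-1).
  apply: (ler_avg x0) => // x; rewrite kE invfM mulrC ler_pM2l ?invr_gt0 //.
  have := y_le s x; have := q_le s x; rewrite !ler_norml => /andP[q1 _] /andP[y1 _].
  have : rho ^+ 2 <= 1 / 16 by nra.
  by lra.
have cov_q s : cov W' f (q s) ^+ 2 <= 32 * rho ^+ 4 * (F * e).
  rewrite (_ : 32 * _ = 2 * (4 * rho ^+ 2) ^+ 2); last by ring.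
  have M0 : 0 < (4 * rho ^+ 2) ^+ 2 by rewrite exprn_gt0 // mulr_gt0 // exprn_gt0.
  apply: (cov_sqr_le_ent x0 W'0 M0 _ f0) => u; have t0 := tilt_gt0 (q s) u W'0.
  apply: le_trans (var_le_sqr_center x0 t0 _ 0) _.
  rewrite -(avg_cst x0 t0 ((4 * rho ^+ 2) ^+ 2)); apply: (ler_avg x0) => // x.
  by rewrite subr0; exact: sqr_le_norm.
have term s : cov W' f (fun x => reweight W y s x / W' x) ^+ 2
     / (mix_prob (reweight W y) s * F) <=
   (4 / (m * F)) * (cov W' f (y s) ^+ 2 + 32 * rho ^+ 4 * (F * e)).
  rewrite (eq_cov W' (frefl f) (kE s)) covZr covDr (cov_cstr x0 W'0) add0r covDr.
  set a := cov W' f (y s); set b := cov W' f (q s).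
  have p0 := mix_prob_gt0 s0 reweight_gt0 s.
  rewrite (ler_pdivrMr _ _ (mulr_gt0 p0 F0)) exprMn.
  have h1 : (a + b) ^+ 2 <= 2 * (a ^+ 2 + 32 * rho ^+ 4 * (F * e)).
    by apply: le_trans (sqrD_le2 _ _) _; rewrite ler_pM2l // lerD2l; exact: cov_q.
  have h0 : 0 <= a ^+ 2 + 32 * rho ^+ 4 * (F * e).
    by rewrite addr_ge0 ?sqr_ge0 // (le_trans _ (cov_q s)) // sqr_ge0.
  have h2 : m^-1 ^+ 2 * (a + b) ^+ 2 <=
      m^-1 ^+ 2 * (2 * (a ^+ 2 + 32 * rho ^+ 4 * (F * e))).
    by rewrite ler_wpM2l // sqr_ge0.
  apply: le_trans h2 _.
  rewrite [X in _ <= X](_ : _ = (4 / m * mix_prob (reweight W y) s) * (a ^+ 2 + 32 * rho ^+ 4 * (F * e))); last first.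
    by field; rewrite !gt_eqF.
  rewrite [X in X <= _]mulrA ler_wpM2r //.
  rewrite (_ : m^-1 ^+ 2 * 2 = 4 / m * (2 * m)^-1); last by field; rewrite gt_eqF.
  by rewrite ler_wpM2l // divr_ge0 // ltW.
apply: (@le_trans _ _ (\sum_s (4 / (m * F)) * (cov W' f (y s) ^+ 2 + 32 * rho ^+ 4 * (F * e)))).
  by apply: ler_sum => s _; exact: term.
rewrite -mulr_sumr big_split /= sum_cst_index.
apply: (@le_trans _ _ (4 / (m * F) * (m * (B * (F * e)) + m * (32 * rho ^+ 4 * (F * e))))).
  by rewrite (ler_pM2l (divr_gt0 _ (mulr_gt0 m0 F0))) // lerD2r.
by rewrite le_eqVlt; apply/orP; left; apply/eqP; field; rewrite !gt_eqF.
Qed.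

End SmallShifts.

End Mixtures.

(** * Local entropies on the hypercube *)

Section Cube.
Variables (R : realType) (n : nat).
Implicit Types (x : cube n) (i j : 'I_n).

Lemma flipK i : involutive (@flip n i).
Proof. by move=> x; apply/ffunP => j; rewrite !ffunE; case: eqP => // _; rewrite negbK. Qed.

Lemma flipC i j x : flip i (flip j x) = flip j (flip i x).
Proof. by apply/ffunP => k; rewrite !ffunE; case: (k == i); case: (k == j). Qed.

Lemma sum_flip i (F : cube n -> R) : \sum_x F (flip i x) = \sum_x F x.
Proof. by rewrite [RHS](reindex_inj (can_inj (flipK i))). Qed.

Lemma sum_flip_pair i (F : cube n -> R) :
  2 * \sum_x F x = \sum_x (F x + F (flip i x)).
Proof. by rewrite big_split /= sum_flip; ring. Qed.

(** Induction on the number of coordinates in which two states differ. *)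
Lemma flip_invariant_cst (A : Type) (g : cube n -> A) :
  (forall i x, g (flip i x) = g x) -> forall x y, g x = g y.
Proof.
move=> gi x y; have [k] := ubnP #|differ x y|; elim: k x => // k IH x.
rewrite ltnS => hk; have [d0|[i di]] := set_0Vmem (differ x y).
  congr g; apply/ffunP => i; apply/eqP; apply: contraT => ne.
  by have : i \in differ x y by [rewrite inE]; rewrite d0 inE.
rewrite -(gi i x); apply: IH; apply: leq_trans hk; apply: proper_card.
have ne : x i != y i by move: di; rewrite inE.
apply/properP; split; last first.
  by exists i => //; rewrite inE ffunE eqxx; move: ne; case: (x i); case: (y i).
apply/subsetP => j; rewrite !inE ffunE; case: (j =P i) => [->|] //.
Qed.

End Cube.

Section LocalEntropy.
Variables (R : realType) (n : nat).
Implicit Types (x : cube n) (i j : 'I_n) (W f g h c : cube n -> R).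

Let x0 : cube n := [ffun=> false].

(** The conditional expectation of [f] given all coordinates but the
    [i]-th, under the measure with weight [W]. *)
Definition resample W i f x : R :=
  (W x * f x + W (flip i x) * f (flip i x)) / (W x + W (flip i x)).

Definition local_ent W i f : R :=
  avg W (fun x => f x * ln (f x / resample W i f x)).

(** Entropies are infima of averages of this nonnegative divergence, which
    makes them monotone in the weight although they are not sums of nonnegative
    terms. *)
Definition bregman (a b : R) : R := a * ln (a / b) - a + b.

Definition approx_tensorization W (C : R) : Prop :=
  forall f, positive f -> ent W f <= C * \sum_i local_ent W i f.

Lemma bregman_ge0 a b : 0 < a -> 0 < b -> 0 <= bregman a b.
Proof. by move=> a0 b0; have := mul_ln_div_ge a0 b0; rewrite /bregman; lra. Qed.

Lemma resample_flip W i f x : resample W i f (flip i x) = resample W i f x.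
Proof. by rewrite /resample flipK addrC (addrC (W x)). Qed.

Section PositiveWeight.
Variable W : cube n -> R.
Hypothesis W_gt0 : positive W.

Lemma pair_weight_gt0 i x : 0 < W x + W (flip i x).
Proof. by rewrite addr_gt0. Qed.

Lemma resample_gt0 i f : positive f -> positive (resample W i f).
Proof. by move=> f0 x; rewrite divr_gt0 ?pair_weight_gt0 // addr_gt0 // mulr_gt0. Qed.

Lemma avg_resample i f h : (forall x, h (flip i x) = h x) ->
  avg W (fun x => resample W i f x * h x) = avg W (fun x => f x * h x).
Proof.
move=> hi; congr (_ / _); apply: (@mulfI R 2) => //.
rewrite !(sum_flip_pair i); apply: eq_bigr => x _; rewrite resample_flip hi /resample.
by field; rewrite gt_eqF ?pair_weight_gt0.
Qed.

Lemma avg_resample1 i f : avg W (resample W i f) = avg W f.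
Proof.
have := @avg_resample i f (fun=> 1) (fun=> erefl).
by rewrite (eq_avg _ (fun x => mulr1 _)) => ->; apply: eq_avg => x; rewrite mulr1.
Qed.

Lemma local_entE i f :
  local_ent W i f = avg W (fun x => bregman (f x) (resample W i f x)).
Proof. by rewrite avgD avgB avg_resample1 subrK. Qed.

(** The conditional expectation minimizes the averaged Bregman divergence
    among the functions that do not depend on the [i]-th coordinate. *)
Lemma local_ent_le_bregman i f c : positive f -> positive c ->
    (forall x, c (flip i x) = c x) ->
  local_ent W i f <= avg W (fun x => bregman (f x) (c x)).
Proof.
move=> f0 c0 ci; rewrite -subr_ge0 -avgB; set r := resample W i f.
have r0 : positive r by exact: resample_gt0.
have -> : avg W (fun x => bregman (f x) (c x) - f x * ln (f x / r x)) =
          avg W (fun x => bregman (r x) (c x)).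
  have -> : avg W (fun x => bregman (f x) (c x) - f x * ln (f x / r x)) =
      avg W (fun x => f x * (ln (r x / c x) - 1) + c x).
    apply: eq_avg => x; rewrite /bregman (ln_divE (f0 x) (c0 x)).
    by rewrite (ln_divE (f0 x) (r0 x)) (ln_divE (r0 x) (c0 x)); ring.
  rewrite avgD -(@avg_resample i) -/r; last by move=> x; rewrite /r resample_flip ci.
  by rewrite -avgD; apply: eq_avg => x; rewrite /bregman; ring.
by apply: (avg_ge0 x0) => // x; exact: bregman_ge0.
Qed.

Lemma ent_bregman f : ent W f = avg W (fun x => bregman (f x) (avg W f)).
Proof. by rewrite avgD avgB (avg_cst x0) // subrK. Qed.

Lemma ent_le_bregman f (c : R) : positive f -> 0 < c ->
  ent W f <= avg W (fun x => bregman (f x) c).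
Proof.
move=> f0 c0; have F0 : 0 < avg W f by exact: (avg_gt0 x0).
rewrite -subr_ge0 -avgB.
have -> : avg W (fun x => bregman (f x) c - f x * ln (f x / avg W f)) =
      avg W (fun x => (ln (avg W f / c) - 1) * f x + c).
  apply: eq_avg => x; rewrite /bregman (ln_divE (f0 x) c0) (ln_divE (f0 x) F0).
  by rewrite (ln_divE F0 c0); ring.
rewrite avgD avgZ (avg_cst x0) //.
by have := bregman_ge0 F0 c0; rewrite /bregman mulrBl mul1r (mulrC (ln _)).
Qed.

(** Gibbs variational principle inside each pair of states that differ
    in the [i]-th coordinate: [g / resample g] is a conditional density. *)
Lemma local_ent_ge i f g : positive f -> positive g ->
  avg W (fun x => f x * ln (g x / resample W i g x)) <= local_ent W i f.
Proof.
move=> f0 g0; rewrite -subr_ge0 -avgB.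
set r := resample W i f; set s := resample W i g.
have r0 : positive r by exact: resample_gt0.
have s0 : positive s by exact: resample_gt0.
have <- : avg W (fun x => f x - g x * (r x / s x)) = 0.
  rewrite avgB -(@avg_resample i) -/s; last by move=> x; rewrite /r /s !resample_flip.
  rewrite -(avg_resample1 i f) -/r; apply/eqP; rewrite subr_eq0; apply/eqP.
  by apply: eq_avg => x; field; rewrite gt_eqF.
apply: (ler_avg x0) => // x.
have d0 : 0 < g x * (r x / s x) by rewrite mulr_gt0 // divr_gt0.
apply: le_trans (mul_ln_div_ge (f0 x) d0) _.
rewrite -mulrBr ler_pM2l // (ln_divE (f0 x) d0) (ln_divE (f0 x) (r0 x)).
rewrite (ln_divE (g0 x) (s0 x)) lnM ?posrE ?(divr_gt0 (r0 x)) //.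
rewrite (ln_divE (r0 x) (s0 x)); lra.
Qed.

End PositiveWeight.

(** The conditional expectation under the mixture is a competitor in the
    variational formula of each component. *)
Lemma local_ent_mix (S : finType) (s0 : S) (Ws : S -> cube n -> R) i f :
    (forall s, positive (Ws s)) -> positive f ->
  \sum_s mix_prob Ws s * local_ent (Ws s) i f <= local_ent (mix Ws) i f.
Proof.
move=> Ws0 f0; have W0 := mix_gt0 s0 Ws0.
rewrite (local_entE W0) (avg_mix x0 s0) //; apply: ler_sum => s _.
rewrite ler_pM2l ?(mix_prob_gt0 x0 s0) //; apply: local_ent_le_bregman => //.
  exact: resample_gt0.
by move=> x; rewrite resample_flip.
Qed.

Lemma avg_le_comparable W W' (d : R) g : positive W -> positive W' -> 0 < d ->
    (forall x, W' x <= W x) -> (forall x, W x <= d * W' x) ->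
    (forall x, 0 <= g x) -> avg W g <= d * avg W' g /\ avg W' g <= d * avg W g.
Proof.
move=> W0 W'0 d0 h1 h2 g0.
have t0 := tot_gt0 x0 W0; have t'0 := tot_gt0 x0 W'0.
have t1 : tot W' <= tot W by apply: ler_sum => x _; exact: h1.
have t2 : tot W <= d * tot W' by rewrite /tot mulr_sumr; apply: ler_sum => x _; exact: h2.
have n0 : 0 <= \sum_x W' x * g x by apply: sumr_ge0 => x _; rewrite mulr_ge0 // ltW.
have n1 : \sum_x W' x * g x <= \sum_x W x * g x.
  by apply: ler_sum => x _; rewrite ler_wpM2r.
have n2 : \sum_x W x * g x <= d * \sum_x W' x * g x.
  by rewrite mulr_sumr; apply: ler_sum => x _; rewrite mulrA ler_wpM2r.
have n3 := le_trans n0 n1.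
split; rewrite /avg mulrA ler_pdivrMr // mulrAC ler_pdivlMr //.
  by apply: ler_pM => //; exact: ltW.
rewrite [d * _]mulrC -mulrA; apply: ler_pM => //; exact: ltW.
Qed.

(** The Holley-Stroock perturbation principle: by their variational formulas
    both sides change by at most the factor [d]. *)
Lemma approx_tensorization_comparable W W' d C :
    positive W -> positive W' -> 0 < d -> 0 <= C ->
    (forall x, W' x <= W x) -> (forall x, W x <= d * W' x) ->
  approx_tensorization W' C -> approx_tensorization W (d ^+ 2 * C).
Proof.
move=> W0 W'0 d0 C0 h1 h2 AT f f0.
have F0 : 0 < avg W' f by exact: (avg_gt0 x0).
have cmp g (g0 : forall x, 0 <= g x) := avg_le_comparable W0 W'0 d0 h1 h2 g0.
apply: le_trans (ent_le_bregman W0 f0 F0) _.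
have [h _] := cmp _ (fun x => bregman_ge0 (f0 x) F0).
apply: le_trans h _; rewrite -(ent_bregman W'0) expr2 -!mulrA ler_pM2l //.
apply: le_trans (AT _ f0) _; rewrite mulrCA ler_wpM2l // mulr_sumr.
apply: ler_sum => i _; have r0 := resample_gt0 W0 i f0.
have ri x : resample W i f (flip i x) = resample W i f x by rewrite resample_flip.
apply: le_trans (local_ent_le_bregman W'0 f0 r0 ri) _.
have [_] := cmp _ (fun x => bregman_ge0 (f0 x) (r0 x)).
by rewrite -(local_entE W0).
Qed.

(** The ratio of the weights of a state and of its flip at [i] does not depend
    on the other coordinates. *)
Definition product_weight W :=
  forall i j x, i != j ->
    W (flip i (flip j x)) * W x = W (flip i x) * W (flip j x).

(** The coordinates are averaged out one after the other; the local entropies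
    bound the successive terms of the telescoping sum for
    [ln (f / sweep W s f)]. *)
Definition sweep W (s : seq 'I_n) f := foldr (fun i g => resample W i g) f s.

Lemma sweep_gt0 W s f : positive W -> positive f -> positive (sweep W s f).
Proof. by move=> W0 f0; elim: s => //= i s; exact: resample_gt0. Qed.

Lemma avg_sweep W s f : positive W -> avg W (sweep W s f) = avg W f.
Proof. by move=> W0; elim: s => //= i s <-; exact: avg_resample1. Qed.

Lemma sweep_ent_le W s f : positive W -> positive f ->
  avg W (fun x => f x * ln (f x / sweep W s f x)) <= \sum_(i <- s) local_ent W i f.
Proof.
move=> W0 f0; elim: s => [|i s IH] /=.
  rewrite big_nil le_eqVlt -(avg_cst x0 W0 0); apply/orP; left; apply/eqP.
  by apply: eq_avg => x; rewrite divff ?ln1 ?mulr0 // gt_eqF.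
have g0 := sweep_gt0 s W0 f0; set g := sweep W s f in g0 IH *.
rewrite big_cons addrC.
apply: le_trans (lerD IH (local_ent_ge W0 i f0 g0)).
rewrite -avgD le_eqVlt; apply/orP; left; apply/eqP; apply: eq_avg => x.
have r0 := resample_gt0 W0 i g0 x.
by rewrite (ln_divE (f0 x) (g0 x)) (ln_divE (g0 x) r0) (ln_divE (f0 x) r0); ring.
Qed.

(** For a product weight the conditional probabilities used to average over
    [i] do not depend on coordinate [j], so that averaging over [i] creates no
    dependence on [j]. *)
Lemma resample_invariant W i j g : positive W -> product_weight W ->
    (forall x, g (flip j x) = g x) ->
  forall x, resample W i g (flip j x) = resample W i g x.
Proof.
move=> W0 Wp gj x; have [->|ij] := eqVneq j i; first exact: resample_flip.
have gij : g (flip i (flip j x)) = g (flip i x) by rewrite flipC gj.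
have e : W (flip i (flip j x)) = W (flip i x) * W (flip j x) / W x.
  by rewrite -Wp 1?eq_sym // mulfK // gt_eqF.
have a0 := W0 x; have b0 := W0 (flip i x); have c0 := W0 (flip j x).
rewrite /resample gj gij e; field.
by rewrite !lt0r_neq0 // addr_gt0 // mulr_gt0.
Qed.

Lemma sweep_invariant W s f i : positive W -> product_weight W -> i \in s ->
  forall x, sweep W s f (flip i x) = sweep W s f x.
Proof.
move=> W0 Wp; elim: s => //= j s IH; rewrite inE => /orP[/eqP -> x|/IH h].
  exact: resample_flip.
exact: resample_invariant.
Qed.

(** After a sweep over all the coordinates nothing but the mean is left. *)
Lemma product_tensorization W : positive W -> product_weight W ->
  approx_tensorization W 1.
Proof.
move=> W0 Wp f f0; rewrite mul1r.
have := sweep_ent_le (index_enum 'I_n) W0 f0.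
suff -> : avg W (fun x => f x * ln (f x / sweep W (index_enum 'I_n) f x)) = ent W f.
  by [].
have cst x y : sweep W (index_enum 'I_n) f x = sweep W (index_enum 'I_n) f y.
  apply: flip_invariant_cst => i z; apply: sweep_invariant => //.
  by rewrite mem_index_enum.
have sE x : sweep W (index_enum 'I_n) f x = avg W f.
  rewrite -(avg_sweep (index_enum 'I_n) f W0).
  by rewrite -[LHS](avg_cst x0 W0); apply: eq_avg => y; exact: cst.
by apply: eq_avg => x; rewrite sE.
Qed.

End LocalEntropy.

(** * Linear statistics and external fields *)

Section DotProduct.
Variables (R : realType) (n : nat).
Implicit Types (a b c : 'cV[R]_n).

Lemma dotpC a b : dotp a b = dotp b a.
Proof. by apply: eq_bigr => i _; rewrite mulrC. Qed.

Lemma dotpDl a b c : dotp (a + b) c = dotp a c + dotp b c.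
Proof. by rewrite -big_split; apply: eq_bigr => i _; rewrite mxE mulrDl. Qed.

Lemma dotpZl k a b : dotp (k *: a) b = k * dotp a b.
Proof. by rewrite /dotp mulr_sumr; apply: eq_bigr => i _; rewrite mxE mulrA. Qed.

Lemma dotpDr a b c : dotp c (a + b) = dotp c a + dotp c b.
Proof. by rewrite !(dotpC c) dotpDl. Qed.

Lemma dotpZr k a b : dotp b (k *: a) = k * dotp b a.
Proof. by rewrite !(dotpC b) dotpZl. Qed.

Lemma dotp_suml (I : finType) (F : I -> 'cV[R]_n) b :
  dotp (\sum_i F i) b = \sum_i dotp (F i) b.
Proof.
rewrite /dotp exchange_big; apply: eq_bigr => k _.
by rewrite summxE mulr_suml.
Qed.

Lemma dotp0l b : dotp 0 b = 0.
Proof. by rewrite -(scale0r b) dotpZl mul0r. Qed.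

Lemma dotp_ge0 a : 0 <= dotp a a.
Proof. by apply: sumr_ge0 => i _; rewrite -expr2 sqr_ge0. Qed.

End DotProduct.

Section LinearStatistics.
Variables (R : realType) (n : nat).
Implicit Types (t p : 'cV[R]_n) (x : cube n) (i j : 'I_n) (W f : cube n -> R).

Let x0 : cube n := [ffun=> false].

Definition spin i x : R := (-1) ^+ x i.

Definition lin t x : R := dotp t (spins R x).

Lemma linE t x : lin t x = \sum_i t i 0 * spin i x.
Proof. by apply: eq_bigr => i _; rewrite mxE. Qed.

Lemma spin_sqr i x : spin i x ^+ 2 = 1.
Proof. by rewrite /spin -exprM mulnC exprM sqrrN expr1n expr1n. Qed.

Lemma spin_flip i x : spin i (flip i x) = - spin i x.
Proof. by rewrite /spin ffunE eqxx; case: (x i); rewrite /= ?expr0 ?expr1 ?opprK. Qed.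

Lemma spin_flip_neq i j x : i != j -> spin i (flip j x) = spin i x.
Proof. by move=> ij; rewrite /spin ffunE (negPf ij). Qed.

Lemma lin_flip t i x : lin t (flip i x) = lin t x - 2 * t i 0 * spin i x.
Proof.
rewrite !linE (bigD1 i) //= [in RHS](bigD1 i) //= spin_flip.
rewrite (eq_bigr (fun j => t j 0 * spin j x)); first by ring.
by move=> j ji; rewrite spin_flip_neq.
Qed.

Definition cov_spin W f : 'cV[R]_n := \col_i cov W f (spin i).

Lemma cov_lin W f t : cov W f (lin t) = dotp t (cov_spin W f).
Proof.
rewrite (@eq_cov _ _ W f _ f (fun x => \sum_i t i 0 * spin i x)) //; last exact: linE.
by rewrite cov_sumr; apply: eq_bigr => i _; rewrite mxE covZr.
Qed.

Definition field_weight p x : R := expR (lin p x).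

Lemma field_weight_gt0 p : positive (field_weight p).
Proof. by move=> x; exact: expR_gt0. Qed.

Lemma field_weight_flip p i x :
  field_weight p (flip i x) = field_weight p x * expR (- (2 * p i 0 * spin i x)).
Proof. by rewrite /field_weight lin_flip expRD. Qed.

Lemma field_weight_product p : product_weight (field_weight p).
Proof.
move=> i j x ij; rewrite !field_weight_flip spin_flip_neq //; ring.
Qed.

(** [m] is [tanh (p i 0)], the mean of the [i]-th spin.  Under an external
    field the spins are independent, so that the centred spin is orthogonal to
    every function of the others. *)
Lemma field_mean p i (u : cube n -> R) :
    (forall x, u (flip i x) = u x) ->
  let m := (1 - expR (- (2 * p i 0))) / (1 + expR (- (2 * p i 0))) in
  avg (field_weight p) (fun x => (spin i x - m) * u x) = 0.
Proof.
move=> ui m; rewrite /avg; suff -> : \sum_x field_weight p x * ((spin i x - m) * u x) = 0.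
  by rewrite mul0r.
apply: (@mulfI R 2) => //; rewrite mulr0 (sum_flip_pair i) big1 // => x _.
rewrite ui spin_flip field_weight_flip /m.
have e2 : expR (2 * p i 0) = (expR (- (2 * p i 0)))^-1 by rewrite expRN invrK.
have := expR_gt0 (- (2 * p i 0)).
rewrite /spin; case: (x i) => /=; rewrite ?expr1 ?expr0 ?mulrN1 ?mulr1 ?opprK ?e2.
  by set E := expR _ => e0; field; rewrite !lt0r_neq0 // addr_gt0.
by set E := expR _ => e0; field; rewrite lt0r_neq0 // addr_gt0.
Qed.

Lemma field_var p t : cov (field_weight p) (lin t) (lin t) <= dotp t t.
Proof.
have W0 := field_weight_gt0 p; set W := field_weight p in W0 *.
pose m i := (1 - expR (- (2 * p i 0))) / (1 + expR (- (2 * p i 0))).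
pose c i x := spin i x - m i.
apply: le_trans (var_le_sqr_center x0 W0 _ (\sum_i t i 0 * m i)) _.
have -> : avg W (fun x => (lin t x - \sum_i t i 0 * m i) ^+ 2) =
    \sum_i \sum_j t i 0 * t j 0 * avg W (fun x => c i x * c j x).
  rewrite (eq_avg _ (g := fun x => \sum_i \sum_j t i 0 * t j 0 * (c i x * c j x))).
    rewrite avg_sum; apply: eq_bigr => i _; rewrite avg_sum; apply: eq_bigr => j _.
    by rewrite avgZ.
  move=> x; rewrite linE -sumrB expr2 mulr_suml; apply: eq_bigr => i _.
  by rewrite mulr_sumr; apply: eq_bigr => j _; rewrite /c; ring.
apply: ler_sum => i _; rewrite (bigD1 i) //= big1 ?addr0; last first.
  move=> j ji; rewrite (_ : avg _ _ = 0) ?mulr0 //; apply: field_mean => x.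
  by rewrite /c spin_flip_neq.
rewrite -[X in _ <= X]mulr1 ler_wpM2l //; first by rewrite -expr2 sqr_ge0.
have z1 : avg W (c i) = 0.
  rewrite -(@field_mean p i (fun=> 1)) //; apply: eq_avg => x.
  by rewrite mulr1.
rewrite (eq_avg _ (g := fun x => - (2 * m i) * c i x + (1 - m i ^+ 2))).
  by rewrite avgD avgZ z1 mulr0 add0r (avg_cst x0) // lerBlDr lerDl sqr_ge0.
by move=> x; have := spin_sqr i x; rewrite /c; nra.
Qed.

End LinearStatistics.

(** * Building the interaction in small steps *)

Section Family.
Variables (R : realType) (n : nat) (S : finType) (s0 : S).
Variables (xi : S -> 'cV[R]_n) (alpha rho : R).
Implicit Types (t p : 'cV[R]_n) (x : cube n) (i : 'I_n) (j N : nat).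
Implicit Types (W f : cube n -> R) (k C : R).

Let x0 : cube n := [ffun=> false].
Let m : R := #|S|%:R.

Hypothesis xi_sum0 : \sum_s xi s = 0.
Hypothesis xi_sqr : forall t, \sum_s dotp (xi s) t ^+ 2 <= m * (alpha * dotp t t).
Hypothesis rho_gt0 : 0 < rho.
Hypothesis xi_small : forall s x, `|lin (xi s) x| <= rho.
Hypothesis alpha_ge0 : 0 <= alpha.

(** The [j]-th interpolating weight with external field [p]. *)
Definition level j p x : R := (\sum_s expR (lin (xi s) x)) ^+ j * expR (lin p x).

Lemma sum_exp_gt0 x : 0 < \sum_s expR (lin (xi s) x).
Proof.
rewrite (bigD1 s0) //= ltr_pwDl ?expR_gt0 // sumr_ge0 // => s _; exact: expR_ge0.
Qed.

Lemma level_gt0 j p : positive (level j p).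
Proof. by move=> x; rewrite mulr_gt0 ?expR_gt0 // exprn_gt0 // sum_exp_gt0. Qed.

Lemma level0 p : level 0 p = field_weight p.
Proof. by apply/funext => x; rewrite /level expr0 mul1r. Qed.

Lemma reweight_level j p s :
  reweight (level j p) (fun s => lin (xi s)) s = level j (p + xi s).
Proof. by apply/funext => x; rewrite /reweight /level /lin dotpDl expRD mulrA. Qed.

Lemma mix_level j p : mix (reweight (level j p) (fun s => lin (xi s))) = level j.+1 p.
Proof.
apply/funext => x; rewrite /mix /reweight -mulr_sumr /level exprSr; ring.
Qed.

Lemma tilt_level j p t u : tilt (level j p) (lin t) u = level j (p + u *: t).
Proof.
by apply/funext => x; rewrite /tilt /level /lin dotpDl dotpZl expRD mulrA.
Qed.

Lemma lin_sum0 x : \sum_s lin (xi s) x = 0.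
Proof. by rewrite /lin -dotp_suml xi_sum0 dotp0l. Qed.

(** Covariances with linear statistics are scalar products with [cov_spin],
    so that the bound on the second moments of [xi] applies. *)
Lemma sum_cov_xi W f : \sum_s cov W f (lin (xi s)) ^+ 2 <=
  m * (alpha * cov W f (lin (cov_spin W f))).
Proof. by under eq_bigr do rewrite cov_lin; rewrite cov_lin. Qed.

Definition cov_bound j k :=
  forall p t, cov (level j p) (lin t) (lin t) <= k * dotp t t.

Lemma cov_bound0 : cov_bound 0 1.
Proof. by move=> p t; rewrite level0 mul1r field_var. Qed.

(** If [d] denotes [cov_spin W g], then [dotp d d] is a covariance between
    two linear statistics, hence at most [k^2 |t|^2] by the Cauchy-Schwarz
    inequality: this produces the quadratic term of the Riccati inequality. *)
Lemma cov_boundS j k a : rho <= 1 / 2 ->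
    (1 + rho) * alpha + 8 * rho ^+ 3 <= (1 - rho) * a -> 1 <= k ->
  cov_bound j k -> cov_bound j.+1 (k + a * k ^+ 2).
Proof.
move=> rho2 ha k1 IH p t; rewrite -mix_level; set g := lin t.
have r0 := rho_gt0; have r1 : 0 < 1 - rho by lra.
have W0 := level_gt0 j p; set W := level j p in W0 *.
set Th := dotp t t; have Th0 : 0 <= Th by exact: dotp_ge0.
pose d := cov_spin W g.
have dd : cov W g (lin d) <= k ^+ 2 * Th.
  have dE : cov W g (lin d) = dotp d d by rewrite cov_lin.
  have dd0 : 0 <= dotp d d by exact: dotp_ge0.
  have : cov W g (lin d) ^+ 2 <= (k * Th) * (k * dotp d d).
    apply: le_trans (cov_le_sqr x0 W0 _ _) _.
    by apply: ler_pM; rewrite ?(var_ge0 x0) //; exact: IH.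
  rewrite dE; have [->|dn0] := eqVneq (dotp d d) 0.
    by rewrite mulr_ge0 ?sqr_ge0.
  have dp : 0 < dotp d d by rewrite lt_def dn0.
  rewrite expr2 (_ : k * Th * _ = k ^+ 2 * Th * dotp d d); last by ring.
  by rewrite ler_pM2r.
have hA : \sum_s cov W g (lin (xi s)) ^+ 2 <= m * (alpha * (k ^+ 2 * Th)).
  apply: le_trans (sum_cov_xi W g) _.
  by rewrite ler_wpM2l ?ler0n // ler_wpM2l.
have hV s : cov (reweight W (fun s => lin (xi s)) s) g g <= k * Th.
  by rewrite reweight_level; exact: IH.
apply: le_trans (var_step x0 s0 W0 lin_sum0 rho_gt0 xi_small rho2 hV (IH p t) hA) _.
rewrite [X in _ <= X]mulrDl lerD2l ler_pdivrMr //.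
have kk : k <= k ^+ 2 by rewrite expr2 ler_peMl //; lra.
have h1 : 8 * rho ^+ 3 * (k * Th) <= 8 * rho ^+ 3 * (k ^+ 2 * Th).
  by rewrite ler_wpM2l ?ler_wpM2r // mulr_ge0 // exprn_ge0 // ltW.
have h2 : ((1 + rho) * alpha + 8 * rho ^+ 3) * (k ^+ 2 * Th) <=
   ((1 - rho) * a) * (k ^+ 2 * Th).
  by rewrite ler_wpM2r // mulr_ge0 ?sqr_ge0.
lra.
Qed.

(** [1 / (1 - a j)] is a supersolution of the Riccati recursion, since its
    increment is the product of [a] and two consecutive values. *)
Lemma cov_bound_level N a : rho <= 1 / 2 ->
    (1 + rho) * alpha + 8 * rho ^+ 3 <= (1 - rho) * a -> 0 <= a -> a * N%:R < 1 ->
  forall j, (j <= N)%N -> cov_bound j (1 - a * N%:R)^-1.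
Proof.
move=> rho2 ha a0 aN.
have pos j : (j <= N)%N -> 0 < 1 - a * j%:R.
  move=> jN; rewrite subr_gt0 (le_lt_trans _ aN) // ler_wpM2l //.
  by rewrite ler_nat.
have main j : (j <= N)%N -> cov_bound j (1 - a * j%:R)^-1.
  elim: j => [|j IH] jN; first by rewrite mulr0 subr0 invr1; exact: cov_bound0.
  have c0 := pos _ (ltnW jN); have c1 := pos _ jN; set c := 1 - a * j%:R in c0 *.
  have ck : 1 <= c^-1.
    by rewrite invr_ge1 ?unitfE ?lt0r_neq0 // ?c0 /c gerBl mulr_ge0.
  move=> p t; apply: le_trans (cov_boundS rho2 ha ck (IH (ltnW jN)) p t) _.
  rewrite ler_wpM2r ?dotp_ge0 //.
  have cE : 1 - a * j.+1%:R = c - a by rewrite /c mulrS; ring.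
  rewrite cE in c1 *; rewrite -subr_ge0.
  rewrite (_ : _ - _ = a ^+ 2 / (c ^+ 2 * (c - a))).
    by rewrite divr_ge0 ?sqr_ge0 // mulr_ge0 ?sqr_ge0 // ltW.
  by field; rewrite !lt0r_neq0.
move=> j jN p t; apply: le_trans (main _ jN p t) _.
rewrite ler_wpM2r ?dotp_ge0 // lef_pV2 ?posrE ?pos // lerD2l lerN2 ler_wpM2l //.
by rewrite ler_nat.
Qed.

(** The covariance bound for the direction [cov_spin W' f] itself turns the
    transport inequality into a bound of the squared displacement of the
    barycenter by the entropy, as [ent_step] requires. *)
Lemma tensorization_level N K r : rho <= 1 / 4 -> 0 < K ->
    (forall j, (j <= N)%N -> cov_bound j K) ->
    4 * (2 * alpha * K + 32 * rho ^+ 4) <= r -> r < 1 ->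
  forall j p, (j <= N)%N -> approx_tensorization (level j p) ((1 - r)^-1 ^+ j).
Proof.
move=> rho4 K0 hK hr r1; have r1' : 0 < 1 - r by rewrite subr_gt0.
elim=> [|j IH] p jN.
  by rewrite expr0 level0; apply: product_tensorization;
     [exact: field_weight_gt0|exact: field_weight_product].
move=> f f0; have W'0 := level_gt0 j.+1 p; have W0 := level_gt0 j p.
have F0 : 0 < avg (level j.+1 p) f by exact: (avg_gt0 x0).
set W' := level j.+1 p in W'0 F0 *; set F := avg W' f in F0 *.
have e0 : 0 <= ent W' f.
  rewrite (ent_bregman W'0); apply: (avg_ge0 x0) => // x; exact: bregman_ge0.
pose d := cov_spin W' f.
have dd : cov W' f (lin d) <= 2 * K * (F * ent W' f).
  have dE : cov W' f (lin d) = dotp d d by rewrite cov_lin.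
  have [d00|dn0] := eqVneq (dotp d d) 0.
    rewrite dE d00; apply: mulr_ge0; first by rewrite mulr_ge0 // ltW.
    exact: mulr_ge0 (ltW F0) e0.
  have dp : 0 < dotp d d by rewrite lt_def dn0 dotp_ge0.
  have := @cov_sqr_le_ent _ _ x0 W' (lin d) (K * dotp d d) f W'0 (mulr_gt0 K0 dp) _ f0.
  rewrite -/F dE expr2.
  have -> : 2 * (K * dotp d d) * (F * ent W' f) = 2 * K * (F * ent W' f) * dotp d d.
    by clearbody F; ring.
  rewrite ler_pM2r //; apply => u; rewrite tilt_level; exact: hK.
have hB : \sum_s cov W' f (lin (xi s)) ^+ 2 <= m * (2 * alpha * K * (F * ent W' f)).
  apply: le_trans (sum_cov_xi W' f) _; rewrite ler_wpM2l ?ler0n //.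
  rewrite (_ : 2 * alpha * K * _ = alpha * (2 * K * (F * ent W' f))); last by ring.
  by rewrite ler_wpM2l.
have := @ent_step _ _ _ x0 s0 _ _ _ W0 lin_sum0 rho_gt0 xi_small f (2 * alpha * K) rho4 f0.
rewrite mix_level => /(_ hB) h.
have h2 : \sum_s mix_prob (reweight (level j p) (fun s => lin (xi s))) s
     * ent (reweight (level j p) (fun s => lin (xi s)) s) f
   <= (1 - r)^-1 ^+ j * \sum_i local_ent W' i f.
  have sh0 := reweight_gt0 (fun s => lin (xi s)) W0.
  apply: (@le_trans _ _ ((1 - r)^-1 ^+ j * \sum_i \sum_s
     mix_prob (reweight (level j p) (fun s => lin (xi s))) s
     * local_ent (reweight (level j p) (fun s => lin (xi s)) s) i f)).
    rewrite exchange_big mulr_sumr; apply: ler_sum => s _.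
    rewrite -mulr_sumr [X in _ <= X]mulrCA ler_pM2l ?(mix_prob_gt0 x0 s0) //.
    by rewrite reweight_level; apply: IH => //; exact: ltnW.
  rewrite ler_wpM2l ?exprn_ge0 ?invr_ge0 ?(ltW r1') //.
  by apply: ler_sum => i _; rewrite /W' -mix_level; exact: local_ent_mix.
have h3 : 4 * (2 * alpha * K + 32 * rho ^+ 4) * ent W' f <= r * ent W' f by rewrite ler_wpM2r.
rewrite exprS -mulrA [X in _ <= X]mulrC ler_pdivlMr //.
rewrite -/W' in h; lra.
Qed.

End Family.

(** * Quadratic forms and the operator norm *)

Section QuadraticForms.
Variables (R : realType) (n : nat).
Implicit Types (t u a b : 'cV[R]_n) (J : 'M[R]_n) (i j : 'I_n).

Lemma dotpE a b : dotp a b = (a^T *m b) 0 0.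
Proof. by rewrite mxE; apply: eq_bigr => i _; rewrite mxE. Qed.

Lemma dotp_mulmx_sym J a b : J^T = J -> dotp a (J *m b) = dotp (J *m a) b.
Proof. by move=> sJ; rewrite !dotpE trmx_mul sJ mulmxA. Qed.

Lemma dotp_delta i a : dotp (delta_mx i 0) a = a i 0.
Proof. by rewrite dotpE trmx_delta -rowE mxE. Qed.

Lemma dotp_eq0 a b : dotp b b = 0 -> dotp a b = 0.
Proof.
move=> /eqP; rewrite /dotp psumr_eq0 => [/allP h|i _]; last by rewrite -expr2 sqr_ge0.
apply: big1 => i _; have := h i (mem_index_enum i).
by rewrite /= mulf_eq0 orbb => /eqP ->; rewrite mulr0.
Qed.

Lemma dotp_sqr_le a b : dotp a b ^+ 2 <= dotp a a * dotp b b.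
Proof.
have [b0|b0] := eqVneq (dotp b b) 0.
  by rewrite (dotp_eq0 a b0) b0 expr0n mulr0.
have bp : 0 < dotp b b by rewrite lt_def b0 dotp_ge0.
have := dotp_ge0 (dotp b b *: a + (- dotp a b) *: b).
rewrite !(dotpDl, dotpDr, dotpZl, dotpZr) (dotpC b a).
rewrite (_ : _ + _ = dotp b b * (dotp a a * dotp b b - dotp a b ^+ 2)); last by ring.
by rewrite pmulr_rge0 // subr_ge0.
Qed.

Definition psd J := forall t, 0 <= dotp t (J *m t).

Lemma quad_shift J a b : J^T = J ->
  dotp (a + b) (J *m (a + b)) =
  dotp a (J *m a) + 2 * dotp a (J *m b) + dotp b (J *m b).
Proof.
move=> sJ; rewrite mulmxDr !(dotpDl, dotpDr) (dotp_mulmx_sym b a sJ).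
rewrite (dotpC (J *m b)); ring.
Qed.

(** Elimination of one variable at a time: subtracting the square that
    involves the [i]-th variable leaves a form with fewer nonzero diagonal
    entries, and a positive semidefinite form with zero diagonal vanishes. *)
Lemma gram J : J^T = J -> psd J ->
  exists s : seq 'cV[R]_n, forall t, dotp t (J *m t) = \sum_(w <- s) dotp w t ^+ 2.
Proof.
have [k] := ubnP #|[set i | J i i != 0]|.
elim: k J => // k IH J hk sJ pJ.
have quad_delta J' i : dotp (delta_mx i 0) (J' *m delta_mx i 0) = J' i i.
  by rewrite dotp_delta -colE mxE.
have [d0|[i]] := set_0Vmem [set i | J i i != 0].
  exists [::] => t; rewrite big_nil.
  have diag i : J i i = 0.
    apply/eqP; apply: contraT => ne.
    by have : i \in [set i | J i i != 0] by [rewrite inE]; rewrite d0 inE.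
  suff -> : J = 0 by rewrite mul0mx dotpC dotp0l.
  apply/matrixP => i j; rewrite mxE.
  have h (c : R) : 0 <= 2 * (c * J i j).
    have := pJ (delta_mx i 0 + c *: delta_mx j 0).
    rewrite quad_shift // quad_delta diag add0r -!scalemxAr !dotpZl !dotpZr quad_delta.
    by rewrite diag !mulr0 addr0 dotp_delta -colE mxE.
  by have := h 1; have := h (- 1); lra.
rewrite inE => Ji0; have Ji : 0 < J i i by rewrite lt_def Ji0 -quad_delta pJ.
pose u := col i J.
pose J' := J - (J i i)^-1 *: (u *m u^T).
have uE t : dotp u t = dotp (delta_mx i 0) (J *m t).
  by rewrite dotp_mulmx_sym // -colE.
have quad t : dotp t (J' *m t) = dotp t (J *m t) - dotp u t ^+ 2 / J i i.
  rewrite mulmxBl dotpDr -scalemxAl -scaleN1r dotpZr dotpZr.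
  suff -> : dotp t (u *m u^T *m t) = dotp u t ^+ 2 by ring.
  rewrite -mulmxA [u^T *m t]mx11_scalar -dotpE mul_mx_scalar dotpZr (dotpC t); ring.
have pJ' : psd J'.
  move=> t; rewrite quad.
  have := pJ (t + (- (dotp u t / J i i)) *: delta_mx i 0).
  rewrite quad_shift // -!scalemxAr !dotpZl !dotpZr quad_delta.
  rewrite (dotp_mulmx_sym t (delta_mx i 0) sJ) (dotpC (J *m t) (delta_mx i 0)) -uE.
  by congr (0 <= _); field; rewrite gt_eqF.
have sJ' : J'^T = J'.
  by rewrite /J' linearB linearZ /= trmx_mul trmxK sJ.
have diag' j : J' j j = J j j - u j 0 ^+ 2 / J i i.
  by rewrite -(quad_delta J' j) quad quad_delta dotpC dotp_delta.
have sub : (#|[set j | J' j j != 0%R]| < k)%N.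
  rewrite -ltnS; apply: leq_trans hk; rewrite ltnS; apply: proper_card.
  apply/properP; split; last first.
    by exists i; rewrite inE // diag' mxE negbK expr2 mulfK ?subrr.
  apply/subsetP => j; rewrite !inE; apply: contra_neq => Jj0.
  apply/eqP; rewrite eq_le -{2}(quad_delta J' j) pJ' andbT diag' Jj0 sub0r oppr_le0.
  by rewrite divr_ge0 ?sqr_ge0 // ltW.
have [s hs] := IH _ sub sJ' pJ'.
exists ((Num.sqrt (J i i))^-1 *: u :: s) => t.
rewrite big_cons -hs quad dotpZl exprMn exprVn sqr_sqrtr; last exact: ltW.
by rewrite [_^-1 * _]mulrC addrC subrK.
Qed.

Lemma norm2_ge0 t : 0 <= norm2 t. Proof. exact: sqrtr_ge0. Qed.

Lemma norm2_sqr t : norm2 t ^+ 2 = dotp t t.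
Proof. by rewrite sqr_sqrtr // dotp_ge0. Qed.

Lemma norm2Z (c : R) t : norm2 (c *: t) = `|c| * norm2 t.
Proof.
by rewrite /norm2 dotpZl dotpZr mulrA -expr2 sqrtrM ?sqr_ge0 // sqrtr_sqr.
Qed.

(** The supremum that defines [opnorm] is meaningful only for a nonempty
    bounded set. *)
Lemma opnorm_has_sup J :
  has_sup [set norm2 (J *m x) | x in [set x : 'cV[R]_n | norm2 x <= 1]]%classic.
Proof.
split.
  exists (norm2 (J *m 0)); exists 0 => //=.
  by rewrite /norm2 dotp0l sqrtr0.
pose B i := \sum_j `|J i j|.
exists (Num.sqrt (\sum_i B i ^+ 2)) => _ [x /= x1 <-].
rewrite /norm2 ler_wsqrtr //; apply: ler_sum => i _; rewrite -expr2.
apply: sqr_le_norm; rewrite mxE; apply: le_trans (ler_norm_sum _ _ _) _.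
apply: ler_sum => j _; rewrite normrM ler_piMr //.
rewrite -(@ler_pXn2r _ 2) ?nnegrE // expr1n real_normK ?num_real //.
apply: (@le_trans _ _ (dotp x x)); last first.
  rewrite -norm2_sqr -[1](expr1n _ 2) ler_pXn2r ?nnegrE ?norm2_ge0 //.
rewrite /dotp (bigD1 j) //= -expr2 lerDl sumr_ge0 // => l _.
by rewrite -expr2 sqr_ge0.
Qed.

Lemma quad_le_opnorm J (q : R) t : opnorm J <= q -> dotp t (J *m t) <= q * dotp t t.
Proof.
move=> hq; have [t0|t0] := eqVneq (dotp t t) 0.
  by rewrite t0 mulr0 dotpC (dotp_eq0 _ t0).
have tp : 0 < dotp t t by rewrite lt_def t0 dotp_ge0.
have np : 0 < norm2 t by rewrite sqrtr_gt0.
have Jt : norm2 (J *m t) <= q * norm2 t.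
  rewrite -ler_pdivrMr // mulrC -[X in X * _]ger0_norm ?invr_ge0 ?norm2_ge0 //.
  rewrite -norm2Z scalemxAr; apply: le_trans hq; apply: sup_upper_bound.
    exact: opnorm_has_sup.
  exists ((norm2 t)^-1 *: t) => //=.
  by rewrite norm2Z ger0_norm ?invr_ge0 ?norm2_ge0 // mulVf // gt_eqF.
apply: le_trans (ler_norm _) _.
have CS : `|dotp t (J *m t)| <= norm2 t * norm2 (J *m t).
  rewrite -(@ler_pXn2r _ 2) ?nnegrE ?mulr_ge0 ?norm2_ge0 //.
  by rewrite real_normK ?num_real // exprMn !norm2_sqr dotp_sqr_le.
apply: le_trans CS _; rewrite -norm2_sqr expr2 mulrCA ler_pM2l //.
Qed.

End QuadraticForms.

(** * Tensorization of entropy for Ising measures *)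

Section Scaling.
Variables (R : realType) (n : nat).
Implicit Types (W f : cube n -> R).

Lemma approx_tensorization_scale W (c C : R) : positive W -> c != 0 ->
  approx_tensorization W C -> approx_tensorization (fun x => c * W x) C.
Proof.
move=> W0 c0 AT f f0; have := AT f f0.
rewrite /ent !avg_scale //; congr (_ <= _ * _); apply: eq_bigr => i _.
rewrite /local_ent avg_scale //; apply: eq_avg => x.
suff -> : resample (fun x => c * W x) i f x = resample W i f x by [].
have h := pair_weight_gt0 W0 i x.
by rewrite /resample; field; rewrite -mulrDr mulf_neq0 // gt_eqF.
Qed.

Lemma approx_tensorization_le W (C C' : R) : positive W -> C <= C' ->
  approx_tensorization W C -> approx_tensorization W C'.
Proof.
move=> W0 CC' AT f f0; apply: le_trans (AT f f0) _.
rewrite ler_wpM2r // sumr_ge0 // => i _; rewrite (local_entE W0).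
apply: (avg_ge0 [ffun=> false]) => // x; apply: bregman_ge0 => //.
exact: resample_gt0.
Qed.

End Scaling.

Section ScalarChoices.
Variable R : realType.

(** The numbers [c] are those for which [c^N] approximates [exp Q]; the
    conditions on [B] make the error in the exponent at most [1]. *)
Lemma exprn_exp_bounds (N : nat) (Q rho c B : R) : (0 < N)%N ->
    0 < rho -> rho <= 1 / 2 -> 0 <= Q -> Q <= B -> 4 * rho * B <= 1 ->
    2 * B ^+ 2 <= N%:R -> B <= N%:R ->
    1 + Q * (1 - rho) / N%:R <= c -> c <= 1 + Q * (1 + 2 * rho) / N%:R ->
  expR (Q - 1) <= c ^+ N <= expR (Q + 1).
Proof.
move=> N_gt0 rho0 rho_le1 Q0 QB rB B2 BN h h'.
have N0 : 0 < N%:R :> R by rewrite ltr0n.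
have rQ : rho * Q <= rho * B by rewrite ler_pM2l.
set z := Q * (1 - rho) / N%:R in h.
have z0 : 0 <= z by rewrite divr_ge0 // mulr_ge0 //; lra.
have zQ : z <= Q / N%:R by rewrite /z ler_pM2r ?invr_gt0 // ler_piMr //; lra.
have QN : Q / N%:R <= 1 by rewrite ler_pdivrMr // mul1r (le_trans QB).
have e1 := le_trans (expR_le1D z0 (le_trans zQ QN)) h.
have c0 : 0 <= c by apply: le_trans (expR_ge0 _) e1.
apply/andP; split.
  apply: (@le_trans _ _ (expR (z - z ^+ 2) ^+ N)); last first.
    by rewrite lerXn2r ?nnegrE ?expR_ge0.
  rewrite -expRM_natl ler_expR mulrBr.
  have -> : N%:R * z = Q * (1 - rho) by rewrite mulrC divfK // gt_eqF.
  have z2 : N%:R * z ^+ 2 <= 1 / 2.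
    apply: (@le_trans _ _ (N%:R * (Q / N%:R) ^+ 2)).
      by rewrite ler_pM2l // lerXn2r // nnegrE divr_ge0.
    rewrite (_ : N%:R * _ = Q ^+ 2 / N%:R); last by field; rewrite gt_eqF.
    rewrite ler_pdivrMr //.
    have : Q ^+ 2 <= B ^+ 2 by rewrite lerXn2r // nnegrE (le_trans Q0).
    by lra.
  by lra.
apply: (@le_trans _ _ (expR (Q * (1 + 2 * rho) / N%:R) ^+ N)).
  by rewrite lerXn2r ?nnegrE ?expR_ge0 // (le_trans h') // expR_ge1Dx.
by rewrite -expRM_natl ler_expR mulrC divfK ?gt_eqF //; lra.
Qed.

Lemma invr1B_exp_le (N : nat) (r : R) : 0 <= r -> r <= 1 / 2 ->
  (1 - r)^-1 ^+ N <= expR (2 * (N%:R * r)).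
Proof.
move=> r0 r2; rewrite mulrCA expRM_natl.
have r1 : 0 < 1 - r by lra.
rewrite lerXn2r ?nnegrE ?expR_ge0 ?invr_ge0 ?(ltW r1) //.
rewrite -[X in _ <= X]invrK -expRN lef_pV2 ?posrE ?expR_gt0 //.
have h : - (2 * r) < 1 by lra.
apply: le_trans (expR_le_inv h) _.
have h' : 0 < 1 - - (2 * r) by lra.
by rewrite -[X in X <= _]mul1r ler_pdivrMr //; nra.
Qed.

(** All the smallness conditions of the interpolation can be met at once: up
    to constants they say that [rho] is small, and [rho] is of order
    [N^(-1/2)]. *)
Lemma step_number (q M L B : R) : 0 < q -> q < 1 / 2 -> 1 <= M -> 1 <= L -> 0 <= B ->
  let K := 2 / (1 - 2 * q) in
  exists N : nat, exists gam : R,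
    [/\ (0 < N)%N, 0 < gam, gam ^+ 2 = 2 * M / N%:R &
     let rho := gam * L in let al := 2 * q / N%:R in
     [/\ rho <= 1 / 4,
        (1 + rho) * al + 8 * rho ^+ 3 <= (1 - rho) * ((1 + 2 * q) / 2 / N%:R),
        4 * (2 * al * K + 32 * rho ^+ 4) <= (16 * q * K + 1) / N%:R,
        (16 * q * K + 1) / N%:R <= 1 / 2 &
        [/\ 4 * rho * B <= 1, 2 * B ^+ 2 <= N%:R & B <= N%:R]]].
Proof.
move=> q0 q2 M1 L1 B0 K.
have qq : 0 < 1 - 2 * q by lra.
have K0 : 0 < K by rewrite divr_gt0.
have KE : K * (1 - 2 * q) = 2 by rewrite divfK // gt_eqF.
clearbody K.
pose beta := 16 * q * K + 1.
have b1 : 1 <= beta.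
  by rewrite /beta lerDr; apply: mulr_ge0 (ltW K0); apply: mulr_ge0 (ltW q0).
(* [rho ^+ 2 = L2 / N] *)
pose L2 : R := 2 * M * L ^+ 2.
have L2_ge1 : 1 <= L2.
  have : 1 <= L ^+ 2 by rewrite expr_ge1 //; lra.
  rewrite /L2; nra.
(* each condition on [rho] has the form [rho * c <= 1]; [D] dominates all
   these constants [c] *)
pose D : R := 4 + (2 * q + 8 * L2 + 1) * K + 128 * L2 + 4 * B.
have DK : 0 <= (2 * q + 8 * L2 + 1) * K.
  by apply: mulr_ge0 (ltW K0); lra.
have D4 : 4 <= D by rewrite /D; lra.
pose X := L2 * D ^+ 2 + 2 * beta + 2 * B ^+ 2 + B.
pose N := Num.bound X.
have L2D : 0 <= L2 * D ^+ 2 by apply: mulr_ge0 (sqr_ge0 _); lra.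
have BB : 0 <= B ^+ 2 by exact: sqr_ge0.
have X0 : 0 <= X by rewrite /X; lra.
have XN : X < N%:R := archi_boundP X0.
have N0 : 0 < N%:R :> R by apply: le_lt_trans XN.
have N1 : (0 < N)%N by rewrite -(ltr0n R).
clearbody N.
have MN : 0 < 2 * M / N%:R by rewrite divr_gt0 //; lra.
pose gam := Num.sqrt (2 * M / N%:R).
have gam0 : 0 < gam by rewrite sqrtr_gt0.
have gam2 : gam ^+ 2 = 2 * M / N%:R by rewrite sqr_sqrtr // ltW.
clearbody gam.
exists N, gam; split=> // rho al.
have rho0 : 0 < rho by rewrite mulr_gt0 //; lra.
have rho2 : rho ^+ 2 = L2 / N%:R by rewrite exprMn gam2 /L2; ring.
clearbody rho.
have rhoD : rho * D <= 1.
  have D0 : 0 <= D by lra.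
  rewrite -(@ler_pXn2r _ 2) ?nnegrE ?(mulr_ge0 (ltW rho0) D0) //.
  rewrite expr1n exprMn rho2 mulrAC ler_pdivrMr // mul1r; rewrite /X in XN; lra.
have rhoE (c : R) : c <= D -> rho * c <= 1.
  by move=> cD; apply: le_trans rhoD; rewrite ler_wpM2l // ltW.
have rho4 : rho <= 1 / 4 by have := rhoE _ D4; lra.
have h128 : rho * (128 * L2) <= 1 by apply: rhoE; rewrite /D; lra.
have hK : rho * ((2 * q + 8 * L2 + 1) * K) <= 1.
  by apply: rhoE => //; rewrite /D; lra.
have hB : rho * (4 * B) <= 1 by apply: rhoE; rewrite /D; lra.
have NX : L2 * D ^+ 2 + 2 * beta + 2 * B ^+ 2 + B < N%:R by [].
clear XN X0; clearbody D X.
split=> //.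
- rewrite -(ler_pM2r N0) -(mulrA (1 - rho)) divfK ?gt_eqF //.
  rewrite (_ : _ * N%:R = (1 + rho) * (2 * q) + 8 * rho * L2); last first.
    by rewrite /al exprS rho2; field; rewrite gt_eqF.
  have h1 : rho * (2 * q + 8 * L2 + 1) <= (1 - 2 * q) / 2.
    rewrite -(ler_pM2r K0) -mulrA; apply: le_trans hK _.
    by rewrite mulrAC (mulrC _ K) KE divff.
  have h2 : rho * q <= rho * (1 / 2) by rewrite ler_pM2l //; lra.
  by lra.
- rewrite -(ler_pM2r N0) divfK ?gt_eqF //.
  rewrite (_ : _ * N%:R = 16 * q * K + 128 * rho * rho * L2); last first.
    by rewrite /al (_ : 4 = 2 + 2)%N // exprD {1}expr2 rho2; field; rewrite gt_eqF.
  rewrite lerD2l (_ : 128 * rho * rho * L2 = rho * (rho * (128 * L2))); last by ring.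
  have : rho * (rho * (128 * L2)) <= rho * 1 by rewrite ler_pM2l.
  by lra.
- by rewrite ler_pdivrMr // -/beta; lra.
- by split; lra.
Qed.

End ScalarChoices.

Section SignedVectors.
Variables (R : realType) (n m : nat) (w : 'I_m.+1 -> 'cV[R]_n) (gam : R).

(** The vectors [+- gam * w k], whose sum vanishes and whose second moments
    are proportional to the quadratic form with squares [w]. *)
Definition signed (s : 'I_m.+1 * bool) : 'cV[R]_n := ((-1) ^+ s.2 * gam) *: w s.1.

Lemma sum_pair_bool (V : nmodType) (I : finType) (F : I * bool -> V) :
  \sum_s F s = \sum_k (F (k, true) + F (k, false)).
Proof.
rewrite (eq_bigr (fun s => F (s.1, s.2))); last by case.
rewrite -(pair_bigA _ (fun k b => F (k, b))) /=; apply: eq_bigr => k _.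
by rewrite big_bool.
Qed.

Lemma card_signed : #|{: 'I_m.+1 * bool}|%:R = 2 * m.+1%:R :> R.
Proof. by rewrite card_prod card_ord card_bool natrM mulrC. Qed.

Lemma signed_sum0 : \sum_s signed s = 0.
Proof.
rewrite sum_pair_bool big1 // => k _.
by rewrite /signed /= -scalerDl expr1 expr0 mulN1r mul1r addNr scale0r.
Qed.

Lemma signed_sqr t :
  \sum_s dotp (signed s) t ^+ 2 = 2 * gam ^+ 2 * \sum_k dotp (w k) t ^+ 2.
Proof.
rewrite sum_pair_bool mulr_sumr; apply: eq_bigr => k _.
by rewrite /signed /= !dotpZl expr1 expr0; ring.
Qed.

Lemma signed_exp_bounds x rho : rho <= 1 / 2 ->
    (forall k, `|gam * lin (w k) x| <= rho) ->
  forall Q, Q = gam ^+ 2 * \sum_k lin (w k) x ^+ 2 ->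
  2 * m.+1%:R + Q * (1 - rho) <= \sum_s expR (lin (signed s) x)
     <= 2 * m.+1%:R + Q * (1 + 2 * rho).
Proof.
move=> rho2 y_le Q Qdef.
have QE : Q = \sum_k (gam * lin (w k) x) ^+ 2.
  by rewrite Qdef mulr_sumr; apply: eq_bigr => k _; rewrite exprMn.
rewrite -lerBrDl -[X in _ && X]lerBlDl.
have -> : \sum_s expR (lin (signed s) x) - 2 * m.+1%:R =
    \sum_k (expR (gam * lin (w k) x) + expR (- (gam * lin (w k) x)) - 2).
  rewrite sumrB sumr_const card_ord -[2 *+ _]mulr_natr; congr (_ - _).
  rewrite sum_pair_bool; apply: eq_bigr => k _.
  by rewrite /lin /signed /= !dotpZl expr1 expr0 mulN1r mul1r mulNr addrC.
rewrite QE !mulr_suml; apply/andP; split; apply: ler_sum => k _;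
  by have /andP[] := cosh_taylor (y_le k) rho2.
Qed.

End SignedVectors.

Section IsingTensorization.
Variables (R : realType) (n : nat) (J : 'M[R]_n) (v : 'cV[R]_n) (q : R).
Implicit Types (t : 'cV[R]_n) (x : cube n).

(** The exponent is the sum of [2 beta], for [N] levels each costing a factor
    at most [exp (2 beta / N)], and of [4], for the comparison of the last level
    with the Ising weight. *)
Definition tensorization_const : R :=
  expR (2 * (16 * q * (2 / (1 - 2 * q)) + 1) + 4).

Lemma spins_sqr x : dotp (spins R x) (spins R x) = n%:R.
Proof.
rewrite /dotp (eq_bigr (fun=> 1)) => [|i _]; first by rewrite sumr_const card_ord.
by rewrite mxE -expr2 (spin_sqr R i x).
Qed.

(** [K] bounds the covariances of all levels, and the last level, normalized,
    lies within a factor [exp 2] below the Ising weight. *)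
Lemma ising_weight_tensorization : 0 < q -> q < 1 / 2 ->
    posdefmx J -> opnorm J <= q ->
  approx_tensorization (ising_weight J v) tensorization_const.
Proof.
move=> q0 q2 [sJ pJ] hop.
have pJ' : psd J.
  move=> t; have [->|t0] := eqVneq t 0; first by rewrite dotp0l.
  exact/ltW/pJ.
have Jle t := quad_le_opnorm t hop.
have [ws hws] := gram sJ pJ'.
(* the default value pads [ws] with a zero vector, so that there is at least
   one direction even if [J] has size zero *)
pose m := size ws; pose w (k : 'I_m.+1) := nth 0 ws k.
have wE t : dotp t (J *m t) = \sum_k dotp (w k) t ^+ 2.
  rewrite hws big_ord_recr /= /w nth_default // dotp0l expr0n addr0.
  by rewrite (big_nth 0) big_mkord.
pose L : R := 1 + \sum_(k < m.+1) \sum_x `|lin (w k) x|.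
have L_ge k x : `|lin (w k) x| <= L.
  rewrite /L (bigD1 k) //= (bigD1 x) //=.
  have h1 : 0 <= \sum_(i | i != x) `|lin (w k) i| by apply: sumr_ge0.
  have h2 : 0 <= \sum_(i < m.+1 | i != k) \sum_x `|lin (w i) x|.
    by apply: sumr_ge0 => i _; apply: sumr_ge0.
  by have := normr_ge0 (lin (w k) x); lra.
have L1 : 1 <= L.
  by rewrite lerDl; apply: sumr_ge0 => k _; apply: sumr_ge0.
clearbody L.
have M1 : 1 <= m.+1%:R :> R by rewrite ler1n.
have [N [gam [N_gt0 gam0 gam2 []]]] := step_number q0 q2 M1 L1 (ler0n R n).
set K := 2 / (1 - 2 * q); set rho := gam * L; set al := 2 * q / N%:R.
set a := (1 + 2 * q) / 2 / N%:R; set r := (16 * q * K + 1) / N%:R.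
move=> rho4 ha hr r2 [rn nN2 nN].
have N0 : 0 < N%:R :> R by rewrite ltr0n.
have N_neq0 : N%:R != 0 :> R by rewrite gt_eqF.
have K0 : 0 < K by rewrite divr_gt0 //; lra.
have rho0 : 0 < rho by rewrite mulr_gt0 //; lra.
have rho_le1 : rho <= 1 / 2 by lra.
pose xi := signed w gam; pose s0 : 'I_m.+1 * bool := (ord0, true).
have al0 : 0 <= al by rewrite divr_ge0 ?(ltW N0) //; lra.
have xi_sum0 : \sum_s xi s = 0 by exact: signed_sum0.
have xi_sqr t : \sum_s dotp (xi s) t ^+ 2 <=
    #|{: 'I_m.+1 * bool}|%:R * (al * dotp t t).
  rewrite signed_sqr card_signed -wE gam2.
  rewrite (_ : 2 * _ * (al * _) = 2 * (2 * m.+1%:R / N%:R) * (q * dotp t t)).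
    by rewrite ler_wpM2l // -gam2 mulr_ge0 // sqr_ge0.
  by rewrite /al; field.
have y_le k x : `|gam * lin (w k) x| <= rho.
  by rewrite normrM (gtr0_norm gam0) ler_pM2l.
have xi_small s x : `|lin (xi s) x| <= rho.
  rewrite /lin dotpZl -mulrA normrM normrX normrN1 expr1n mul1r; exact: y_le.
have a0 : 0 <= a by rewrite divr_ge0 ?(ltW N0) //; lra.
have aN : a * N%:R = (1 + 2 * q) / 2 by rewrite divfK.
have aN1 : a * N%:R < 1 by rewrite aN; lra.
have KE : (1 - a * N%:R)^-1 = K by rewrite aN /K; field; rewrite !gt_eqF //; lra.
have r1 : r < 1 by lra.
have cb := cov_bound_level s0 xi_sum0 xi_sqr rho0 xi_small al0 rho_le1 ha a0 aN1.
rewrite KE in cb.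
have AT := tensorization_level s0 xi_sum0 xi_sqr rho0 xi_small al0 rho4 K0 cb hr
  r1 v (leqnn N).
pose Q x := dotp (spins R x) (J *m spins R x).
have Q0 x : 0 <= Q x by exact: pJ'.
have Qn x : Q x <= n%:R.
  apply: le_trans (Jle _) _; rewrite spins_sqr ler_piMl //; lra.
have M0 : 0 < 2 * m.+1%:R :> R by lra.
pose c x := (2 * m.+1%:R)^-1 * \sum_s expR (lin (xi s) x).
have c_bounds x : expR (Q x - 1) <= c x ^+ N <= expR (Q x + 1).
  have /andP[h1 h2] := signed_exp_bounds rho_le1 (y_le^~ x) (erefl _).
  rewrite gam2 -wE -/(Q x) in h1 h2.
  apply: (exprn_exp_bounds N_gt0 rho0 rho_le1 (Q0 x) (Qn x) rn nN2 nN).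
    rewrite /c ler_pdivlMl //; apply: le_trans h1.
    by rewrite le_eqVlt; apply/orP; left; apply/eqP; field.
  rewrite /c ler_pdivrMl //; apply: le_trans h2 _.
  by rewrite le_eqVlt; apply/orP; left; apply/eqP; field.
(* the normalization for which the last level lies below the Ising weight *)
pose e : R := expR (- 1) * (2 * m.+1%:R)^-1 ^+ N.
have e0 : 0 < e by rewrite mulr_gt0 ?expR_gt0 // exprn_gt0 // invr_gt0.
pose W' x := e * level xi N v x.
have lev0 := level_gt0 s0 xi N v.
have W'0 : positive W' by move=> x; rewrite mulr_gt0.
have W0 : positive (ising_weight J v) by move=> x; exact: expR_gt0.
have W'E x : W' x = expR (- 1) * c x ^+ N * expR (lin v x).
  by rewrite /W' /e /level /c exprMn; ring.
have WE x : ising_weight J v x = expR (Q x) * expR (lin v x).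
  by rewrite /ising_weight expRD /lin (dotpC v).
have AT' : approx_tensorization W' ((1 - r)^-1 ^+ N).
  by apply: approx_tensorization_scale => //; rewrite gt_eqF.
have rN0 : 0 <= (1 - r)^-1 ^+ N by rewrite exprn_ge0 // invr_ge0; lra.
have low x : W' x <= ising_weight J v x.
  have /andP[_ h] := c_bounds x.
  rewrite W'E WE ler_pM2r ?expR_gt0 // -[Q x](addrK 1) addrC expRD.
  by rewrite ler_pM2l ?expR_gt0.
have up x : ising_weight J v x <= expR 2 * W' x.
  have /andP[h _] := c_bounds x.
  rewrite W'E WE mulrA ler_pM2r ?expR_gt0 // mulrA -expRD.
  have -> : Q x = (2 + -1) + (Q x - 1) by ring.
  by rewrite [X in X <= _]expRD ler_pM2l ?expR_gt0.
apply: approx_tensorization_le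
  (approx_tensorization_comparable W0 W'0 (expR_gt0 2) rN0 low up AT') => //.
have -> : tensorization_const = expR 2 ^+ 2 * expR (2 * (16 * q * K + 1)).
  by rewrite /tensorization_const -/K -expRM_natl -expRD; congr expR; clearbody K; ring.
rewrite ler_pM2l ?exprn_gt0 ?expR_gt0 //.
have r0 : 0 <= r.
  by apply: divr_ge0 (ltW N0); apply: addr_ge0 => //; apply: mulr_ge0 (ltW K0); lra.
apply: le_trans (invr1B_exp_le N r0 r2) _.
by rewrite ler_expR (mulrC N%:R) divfK.
Qed.

End IsingTensorization.

(** * Entropy contraction of the Glauber dynamics *)

Section Glauber.
Variables (R : realType) (n : nat) (nu : cube n -> R).
Implicit Types (x y z : cube n) (i j : 'I_n) (mu f : cube n -> R).
Hypothesis n_gt0 : (0 < n)%N.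
Hypothesis nu_gt0 : positive nu.

Let x0 : cube n := [ffun=> false].
Let step := kernel_step (glauber nu).

(** The law after resampling the [i]-th coordinate of a state with law
    [mu]. *)
Definition update i mu y : R :=
  (mu y + mu (flip i y)) * (nu y / (nu y + nu (flip i y))).

Lemma differ_flip i x y : (differ x y == [set i]) = (x == flip i y).
Proof.
apply/eqP/eqP => [/setP h|->].
  apply/ffunP => j; have := h j; rewrite !inE ffunE.
  by case: (j == i); case: (x j); case: (y j).
by apply/setP => j; rewrite !inE ffunE; case: (j == i); case: (y j).
Qed.

Lemma flip_neq i x : (x == flip i x) = false.
Proof. by apply/eqP => /ffunP/(_ i); rewrite ffunE eqxx; case: (x i). Qed.

(** A single formula for the three cases of the kernel: choose a uniform
    coordinate and resample it. *)
Lemma glauberE x y : glauber nu x y =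
  n%:R^-1 * \sum_i ((x == y)%:R + (x == flip i y)%:R) * (nu y / (nu y + nu (flip i y))).
Proof.
rewrite /glauber; case: ifP => [/cards1P[i di]|d1].
  have xE : x = flip i y by apply/eqP; rewrite -differ_flip di.
  rewrite (bigD1 i) //= big1 ?addr0.
    by rewrite xE eqxx [_ == y]eq_sym flip_neq add0r mul1r (addrC (nu y)).
  move=> j ji; rewrite -!differ_flip di (_ : [set i] == [set j] = false).
    by rewrite xE [_ == y]eq_sym flip_neq addr0 mul0r.
  by apply/eqP => /setP/(_ j); rewrite !inE eqxx (negPf ji).
have nflip i : (x == flip i y) = false.
  apply: contraFF d1 => h; apply/cards1P; exists i; apply/eqP.
  by rewrite differ_flip.
rewrite eq_sym; case: (x =P y) => [->|_].
  by congr (_ * _); apply: eq_bigr => i _; rewrite flip_neq addr0 mul1r.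
by rewrite big1 ?mulr0 // => i _; rewrite nflip addr0 mul0r.
Qed.

Lemma glauber_step mu y : step mu y = n%:R^-1 * \sum_i update i mu y.
Proof.
rewrite /step /kernel_step; under eq_bigr do rewrite glauberE mulrCA mulr_sumr.
rewrite -mulr_sumr exchange_big /=; congr (_ * _); apply: eq_bigr => i _.
rewrite /update; set B := nu y / _; under eq_bigr do rewrite (mulrA _ _ B).
rewrite -mulr_suml; congr (_ * _).
have pick z : \sum_x mu x * (x == z)%:R = mu z.
  rewrite (bigD1 z) //= eqxx mulr1 big1 ?addr0 // => x xz.
  by rewrite (negPf xz) mulr0.
by under eq_bigr do rewrite mulrDr; rewrite big_split /= !pick.
Qed.

Lemma update_sum (I : finType) (P : pred I) (F : I -> cube n -> R) i y :
  update i (fun z => \sum_(k | P k) F k z) y = \sum_(k | P k) update i (F k) y.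
Proof. by rewrite /update -big_split /= mulr_suml. Qed.

Lemma update_ge0 i mu : (forall z, 0 <= mu z) -> forall y, 0 <= update i mu y.
Proof.
move=> mu0 y; rewrite mulr_ge0 ?addr_ge0 ?divr_ge0 ?addr_ge0 //; exact/ltW/nu_gt0.
Qed.

Lemma update_nu i y : update i nu y = nu y.
Proof. by rewrite /update mulrC divfK // gt_eqF // addr_gt0. Qed.

Lemma sum_update i mu : \sum_y update i mu y = \sum_y mu y.
Proof.
apply: (@mulfI R 2) => //; rewrite !(sum_flip_pair i); apply: eq_bigr => y _.
rewrite /update flipK; field.
by rewrite !lt0r_neq0 // addr_gt0.
Qed.

Lemma n_neq0 : n%:R != 0 :> R. Proof. by rewrite pnatr_eq0 -lt0n. Qed.

Lemma step_nu y : step nu y = nu y.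
Proof.
rewrite glauber_step (eq_bigr (fun=> nu y)) => [|i _]; last exact: update_nu.
by rewrite sumr_const card_ord -[nu y *+ n]mulr_natl mulKf ?n_neq0.
Qed.

Lemma sum_step mu : \sum_y step mu y = \sum_y mu y.
Proof.
under eq_bigr do rewrite glauber_step.
rewrite -mulr_sumr exchange_big /=; under eq_bigr do rewrite sum_update.
by rewrite sumr_const card_ord -[(\sum_y mu y) *+ n]mulr_natl mulKf ?n_neq0.
Qed.

Lemma step_ge0 mu : (forall z, 0 <= mu z) -> forall y, 0 <= step mu y.
Proof.
move=> mu0 y; rewrite glauber_step mulr_ge0 ?invr_ge0 // sumr_ge0 // => i _.
exact: update_ge0.
Qed.

Lemma step_gt0 mu : positive mu -> positive (step mu).
Proof.
move=> mu0 y; rewrite glauber_step mulr_gt0 ?invr_gt0 ?ltr0n //.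
rewrite (bigD1 (Ordinal n_gt0)) //= ltr_pwDl //.
  by rewrite mulr_gt0 ?divr_gt0 ?addr_gt0.
by rewrite sumr_ge0 // => i _; apply: update_ge0 => z; exact: ltW.
Qed.

Lemma stepL (a b : R) mu mu' y :
  step (fun z => a * mu z + b * mu' z) y = a * step mu y + b * step mu' y.
Proof.
rewrite /step /kernel_step !mulr_sumr -big_split; apply: eq_bigr => z _ /=; ring.
Qed.

Lemma eq_step mu mu' : mu =1 mu' -> step mu =1 step mu'.
Proof. by move=> e; rewrite (funext e). Qed.

Definition density mu x : R := mu x / nu x.

Lemma density_gt0 mu : positive mu -> positive (density mu).
Proof. by move=> mu0 x; rewrite divr_gt0. Qed.

Lemma density_step mu x :
  density (step mu) x = n%:R^-1 * \sum_i resample nu i (density mu) x.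
Proof.
rewrite /density glauber_step -mulrA mulr_suml; congr (_ * _).
apply: eq_bigr => i _; rewrite /update /resample !(mulrC (nu _)) !divfK ?gt_eqF //.
by field; rewrite !gt_eqF // addr_gt0.
Qed.

Lemma avg_density mu : avg nu (density mu) = (\sum_x mu x) / tot nu.
Proof.
by congr (_ / _); apply: eq_bigr => x _; rewrite /density mulrC divfK // gt_eqF.
Qed.

(** Chain rule: resampling removes exactly the conditional part of the
    entropy. *)
Lemma ent_resample i f : positive f ->
  ent nu (resample nu i f) = ent nu f - local_ent nu i f.
Proof.
move=> f0; rewrite /ent avg_resample1 //; set F := avg nu f.
have F0 : 0 < F by exact: (avg_gt0 x0).
have r0 := resample_gt0 nu_gt0 i f0.
rewrite (@avg_resample _ _ _ nu_gt0 i f (fun x => ln (resample nu i f x / F))).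
  rewrite -avgB; apply: eq_avg => x.
  rewrite (ln_divE (r0 x) F0) (ln_divE (f0 x) F0) (ln_divE (f0 x) (r0 x)); ring.
by move=> x; rewrite resample_flip.
Qed.

(** The index of the mixture carries only a small part of the entropy:
    the posterior probability of [s] is [(1 + y s x) / m] up to a relative error
    [O(rho^2)].  The hypothesis controls the contribution of the first order
    term, and [cov_sqr_le_ent] for a bounded function that of the error. *)
(** The density after a step is the average of the resampled densities, and
    entropy is convex. *)
Lemma ent_step_le mu : positive mu ->
  ent nu (density (step mu)) <=
    ent nu (density mu) - n%:R^-1 * \sum_i local_ent nu i (density mu).
Proof.
move=> mu0; have f0 := density_gt0 mu0; set f := density mu in f0 *.
pose F := avg nu f; have F0 : 0 < F by exact: (avg_gt0 x0).
have r0 i : positive (resample nu i f) by exact: resample_gt0.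
have g0 := density_gt0 (step_gt0 mu0); set g := density (step mu) in g0 *.
have gE x : \sum_i resample nu i f x = n%:R * g x.
  by rewrite /g density_step mulrA divff ?mul1r // n_neq0.
have FE : avg nu g = F by rewrite /F !avg_density sum_step.
have nE : n%:R^-1 * n%:R = 1 :> R by rewrite mulVf // n_neq0.
apply: (@le_trans _ _ (n%:R^-1 * \sum_i ent nu (resample nu i f))); last first.
  under eq_bigr do rewrite ent_resample //.
  by rewrite sumrB sumr_const card_ord -[ent nu f *+ n]mulr_natl mulrBr mulrA nE mul1r.
rewrite /ent FE -avg_sum -avgZ; apply: (ler_avg x0) => // x.
rewrite -(ler_pM2l (_ : 0 < n%:R)) ?ltr0n // [X in _ <= X]mulrA (mulrC n%:R _^-1) nE mul1r.
rewrite mulrA -gE mulr_suml -subr_ge0 -sumrB.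
apply: (@le_trans _ _ (\sum_i (resample nu i f x - g x))).
  by rewrite sumrB gE sumr_const card_ord -[g x *+ n]mulr_natl subrr.
apply: ler_sum => i _; rewrite avg_resample1 // -/F -mulrBr.
apply: le_trans (mul_ln_div_ge (r0 i x) (g0 x)) _.
rewrite (ler_pM2l (r0 i x)) (ln_divE (r0 i x) (g0 x)) (ln_divE (r0 i x) F0) (ln_divE (g0 x) F0).
by lra.
Qed.

(** The index of the mixture carries only a small part of the entropy:
    the posterior probability of [s] is [(1 + y s x) / m] up to a relative error
    [O(rho^2)].  The hypothesis controls the contribution of the first order
    term, and [cov_sqr_le_ent] for a bounded function that of the error. *)
Lemma ent_step_contract (C : R) mu : 1 <= C -> approx_tensorization nu C -> positive mu ->
  ent nu (density (step mu)) <= (1 - (C * n%:R)^-1) * ent nu (density mu).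
Proof.
move=> C1 AT mu0; apply: le_trans (ent_step_le mu0) _.
rewrite mulrBl mul1r lerD2l lerN2; set e := ent _ _.
have -> : (C * n%:R)^-1 * e = n%:R^-1 * (C^-1 * e) by rewrite invfM mulrA (mulrC n%:R^-1).
rewrite ler_wpM2l ?invr_ge0 // ler_pdivrMl; last by lra.
exact/AT/density_gt0.
Qed.

Lemma iter_step_gt0 s mu : positive mu -> positive (iter s step mu).
Proof. by move=> mu0; elim: s => //= s; exact: step_gt0. Qed.

Lemma iter_sum_step s mu : \sum_y iter s step mu y = \sum_y mu y.
Proof. by elim: s => //= s <-; exact: sum_step. Qed.

Lemma iter_step_ge0 s mu : (forall y, 0 <= mu y) -> forall y, 0 <= iter s step mu y.
Proof. by move=> mu0; elim: s => //= s; exact: step_ge0. Qed.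

Lemma iter_step_nu s : iter s step nu = nu.
Proof. by elim: s => //= s ->; apply/funext => y; exact: step_nu. Qed.

Lemma iter_stepL s (a b : R) mu mu' y :
  iter s step (fun z => a * mu z + b * mu' z) y =
  a * iter s step mu y + b * iter s step mu' y.
Proof.
elim: s y => //= s IH y; rewrite (eq_step IH) stepL //.
Qed.

Lemma ent_iter_step (C : R) s mu : 1 <= C -> approx_tensorization nu C -> positive mu ->
  ent nu (density (iter s step mu)) <=
    (1 - (C * n%:R)^-1) ^+ s * ent nu (density mu).
Proof.
move=> C1 AT mu0; elim: s => [|s IH]; first by rewrite expr0 mul1r.
apply: le_trans (ent_step_contract C1 AT (iter_step_gt0 s mu0)) _.
rewrite exprS -mulrA ler_wpM2l // subr_ge0 invf_le1.
  by rewrite mulr_ege1 // ler1n.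
by rewrite mulr_gt0 ?ltr0n //; lra.
Qed.

(** Pinsker's inequality, up to the constant: the variance of an indicator is
    at most [1]. *)
Lemma mass_dev_le mu (A : {set cube n}) : positive mu ->
    \sum_y mu y = 1 -> \sum_y nu y = 1 ->
  (mass mu A - mass nu A) ^+ 2 <= 2 * ent nu (density mu).
Proof.
move=> mu0 mu1 nu1; have f0 := density_gt0 mu0.
pose a x : R := (x \in A)%:R.
have F1 : avg nu (density mu) = 1 by rewrite avg_density mu1 /tot nu1 divr1.
have massE m : mass m A = \sum_x m x * a x.
  rewrite /mass big_mkcond; apply: eq_bigr => x _; rewrite /a.
  by case: (x \in A); rewrite ?mulr1 ?mulr0.
have -> : mass mu A - mass nu A = cov nu (density mu) a.
  rewrite /cov F1 mul1r !massE /avg /tot nu1 !divr1; congr (_ - _).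
  by apply: eq_bigr => x _; rewrite mulrA /density [nu x * _]mulrC divfK // gt_eqF.
have := @cov_sqr_le_ent _ _ x0 nu a 1 _ nu_gt0 ltr01 _ f0.
rewrite F1 mulr1 mul1r; apply => u; have t0 := tilt_gt0 a u nu_gt0.
apply: le_trans (var_le_sqr_center x0 t0 a 0) _.
rewrite -(avg_cst x0 t0 1); apply: (ler_avg x0) => // x.
by rewrite subr0 /a; case: (x \in A); rewrite ?expr1n ?expr0n.
Qed.

End Glauber.

(** * Burn-in until every coordinate has been refreshed *)

Section BurnIn.
Variables (R : realType) (n : nat) (nu : cube n -> R).
Implicit Types (x y z : cube n) (i j : 'I_n) (mu f : cube n -> R) (A T : {set 'I_n}).
Hypothesis n_gt0 : (0 < n)%N.
Hypothesis nu_gt0 : positive nu.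

(** The part of the law of the chain after [t] steps started at [x] for which
    exactly the coordinates in [A] have been chosen so far. *)
Fixpoint history x t A y : R :=
  if t is t'.+1 then
    n%:R^-1 * \sum_i \sum_(B | i |: B == A) update nu i (history x t' B) y
  else if A == set0 then dirac_mass R x y else 0.

Lemma history_ge0 x t A y : 0 <= history x t A y.
Proof.
elim: t A y => [|t IH] A y /=; first by case: ifP => // _; rewrite ler0n.
rewrite mulr_ge0 ?invr_ge0 // sumr_ge0 // => i _; rewrite sumr_ge0 // => B _.
exact: update_ge0.
Qed.

Lemma sum_adjoin (V : nmodType) i (P : pred {set 'I_n}) (F : {set 'I_n} -> V) :
  \sum_(A | P A) \sum_(B | i |: B == A) F B = \sum_(B | P (i |: B)) F B.
Proof.
rewrite (exchange_big_dep xpredT) //= [RHS]big_mkcond /=; apply: eq_bigr => B _.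
rewrite big_mkcondl /= (bigD1 (i |: B)) //= big1 ?addr0 // => A /andP[/eqP <-].
by rewrite eqxx.
Qed.

Lemma sum_history x t y : \sum_A history x t A y = kernel_law (glauber nu) t x y.
Proof.
elim: t y => [|t IH] y.
  by rewrite (bigD1 set0) //= eqxx big1 ?addr0 // => A /negPf ->.
rewrite /kernel_law /= -[RHS]/(kernel_step (glauber nu) (kernel_law (glauber nu) t x) y).
rewrite glauber_step // -mulr_sumr; congr (_ * _); rewrite exchange_big /=.
apply: eq_bigr => i _; rewrite (sum_adjoin i xpredT) -update_sum.
by rewrite /update !IH.
Qed.

(** The choices of coordinates are independent of the states. *)
Lemma total_history_missing x t i :
  \sum_(A : {set 'I_n} | i \notin A) \sum_y history x t A y = (1 - n%:R^-1) ^+ t.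
Proof.
elim: t => [|t IH].
  rewrite (bigD1 set0) ?inE //= eqxx [X in _ + X]big1 => [|A /andP[_ /negPf ->]]; last exact: big1.
  rewrite addr0 (bigD1 x) //= /dirac_mass eqxx big1 ?addr0 // => y /negPf.
  by move=> ->.
(* among the [n] possible choices only [i] itself adjoins [i] *)
have E : \sum_(A : {set 'I_n} | i \notin A) \sum_y history x t.+1 A y =
    n%:R^-1 * \sum_j \sum_(B : {set 'I_n} | i \notin j |: B) \sum_y history x t B y.
  rewrite mulr_sumr exchange_big /=.
  under eq_bigr => y _ do rewrite -mulr_sumr exchange_big /=.
  rewrite -mulr_sumr exchange_big /= -mulr_sumr; congr (_ * _); apply: eq_bigr => j _.
  under eq_bigr => y _ do rewrite (sum_adjoin j (fun A => i \notin A)).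
  rewrite exchange_big /=; apply: eq_bigr => B _; exact: sum_update.
rewrite E (bigD1 i) //= big1 ?add0r => [|B]; last by rewrite !inE eqxx.
rewrite (eq_bigr (fun=> (1 - n%:R^-1) ^+ t)) => [|j ji]; last first.
  rewrite -IH; apply: eq_bigl => B; rewrite !inE negb_or eq_sym ji //.
rewrite sumr_const cardC1 card_ord -[_ *+ n.-1]mulr_natl mulrA exprS; congr (_ * _).
rewrite -subn1 natrB // mulrBr mulVf ?mulr1 //.
by rewrite pnatr_eq0 -lt0n.
Qed.

(** Sums over [z] with [agree T y z] are marginals on the coordinates in
    [T]. *)
Definition agree T y z := [forall (i | i \in T), z i == y i].

Lemma agreeT y z : agree [set: 'I_n] y z = (z == y).
Proof.
apply/forall_inP/eqP => [h|-> //]; apply/ffunP => i; apply/eqP; exact: h.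
Qed.

Lemma agree_flip T y z i : i \notin T -> agree T y (flip i z) = agree T y z.
Proof.
move=> iT; apply: eq_forallb_in => j jT; rewrite ffunE; case: (j =P i) => // ji.
by rewrite -ji jT in iT.
Qed.

Variable b : 'I_n -> bool -> R.
Hypothesis b_ge : forall i y, nu y / (nu y + nu (flip i y)) <= b i (y i).

(** The new value at [i] is drawn last, with conditional probability at most
    [b i (y i)], whatever the other coordinates are. *)
Lemma marginal_update_in i T mu y : (forall z, 0 <= mu z) -> i \in T ->
  \sum_(z | agree T y z) update nu i mu z <=
  b i (y i) * \sum_(z | agree (T :\ i) y z) mu z.
Proof.
move=> mu0 iT.
have -> : \sum_(z | agree (T :\ i) y z) mu z =
    \sum_(z | agree T y z) (mu z + mu (flip i z)).
  rewrite (bigID (fun z => z i == y i)) big_split /=; congr (_ + _).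
    apply: eq_bigl => z; apply/andP/forall_inP => [[/forall_inP h zi] j jT|h].
      by have [->//|ji] := eqVneq j i; apply: h; rewrite !inE ji.
    by split; [apply/forall_inP => j; rewrite !inE => /andP[_ /h]|exact: h].
  rewrite (reindex_inj (can_inj (@flipK _ i))) /=; apply: eq_bigl => z.
  rewrite agree_flip ?inE ?eqxx // ffunE eqxx.
  apply/andP/forall_inP => [[/forall_inP h zi] j jT|h].
    have [->|ji] := eqVneq j i; last by apply: h; rewrite !inE ji.
    by move: zi; case: (z i); case: (y i).
  split; first by apply/forall_inP => j; rewrite !inE => /andP[_ /h].
  by have /eqP -> := h i iT; case: (y i).
rewrite mulr_sumr; apply: ler_sum => z /forall_inP/(_ i iT)/eqP zi.
by rewrite /update mulrC ler_wpM2r ?addr_ge0 // -zi.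
Qed.

Lemma marginal_update_notin i T mu y : i \notin T ->
  \sum_(z | agree T y z) update nu i mu z = \sum_(z | agree T y z) mu z.
Proof.
move=> iT; apply: (@mulfI R 2) => //.
have two (F : cube n -> R) : 2 * \sum_(z | agree T y z) F z =
    \sum_(z | agree T y z) (F z + F (flip i z)).
  rewrite big_split /= [X in _ + X](_ : _ = \sum_(z | agree T y z) F z); first by ring.
  rewrite [RHS](reindex_inj (can_inj (@flipK _ i))) /=.
  by apply: eq_bigl => z; rewrite agree_flip.
rewrite !two; apply: eq_bigr => z _; rewrite /update flipK; field.
by rewrite !lt0r_neq0 // addr_gt0.
Qed.

(** Marginals on arbitrary sets of refreshed coordinates are needed for the
    induction: refreshing [i] again discards its old value, and only the marginal
    on the other coordinates of [T] survives. *)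
Lemma marginal_history x t A T y : T \subset A ->
  \sum_(z | agree T y z) history x t A z <=
  (\sum_z history x t A z) * \prod_(i in T) b i (y i).
Proof.
have b0 i : 0 <= b i (y i).
  by apply: le_trans (b_ge i y); rewrite divr_ge0 ?addr_ge0 // ltW.
elim: t A T => [|t IH] A T TA.
  have [A0|A0] := eqVneq A set0; last first.
    have z0 (P : pred (cube n)) : \sum_(z | P z) history x 0 A z = 0.
      by apply: big1 => z _; rewrite /= (negPf A0).
    by rewrite !z0 mul0r.
  move: TA; rewrite A0 subset0 => /eqP ->; rewrite big_set0 mulr1.
  by rewrite big_mkcond; apply: ler_sum => z _; case: (agree _ _ _); rewrite ?history_ge0.
have sumE P : \sum_(z | P z) history x t.+1 A z =
    n%:R^-1 * \sum_i \sum_(B | i |: B == A) \sum_(z | P z) update nu i (history x t B) z.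
  rewrite -mulr_sumr exchange_big /=; congr (_ * _); apply: eq_bigr => i _.
  by rewrite exchange_big.
rewrite !sumE -mulrA ler_wpM2l ?invr_ge0 // mulr_suml; apply: ler_sum => i _.
rewrite mulr_suml; apply: ler_sum => B /eqP BA.
rewrite sum_update //.
have [iT|iT] := boolP (i \in T).
  apply: le_trans (marginal_update_in _ _ iT) _; first exact: history_ge0.
  rewrite (big_setD1 i iT) /= mulrCA ler_wpM2l // IH //.
  by rewrite subDset; rewrite BA.
rewrite marginal_update_notin // IH //.
apply/subsetP => j jT; have := subsetP TA j jT; rewrite -BA !inE.
by case: eqP => // ji; rewrite -ji jT in iT.
Qed.

Lemma history_full_le x t y :
  history x t [set: 'I_n] y <=
  (\sum_z history x t [set: 'I_n] z) * \prod_i b i (y i).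
Proof.
have := @marginal_history x t [set: 'I_n] [set: 'I_n] y (subxx _).
rewrite (big_pred1 y) => [|z]; last exact: agreeT.
by rewrite (eq_bigl xpredT) // => i; rewrite inE.
Qed.

Lemma history_missing_le x t :
  \sum_(A : {set 'I_n} | A != [set: 'I_n]) \sum_y history x t A y <=
  n%:R * (1 - n%:R^-1) ^+ t.
Proof.
have m0 A : 0 <= \sum_y history x t A y by apply: sumr_ge0 => y _; exact: history_ge0.
have -> : n%:R * (1 - n%:R^-1) ^+ t =
    \sum_i \sum_(A : {set 'I_n} | i \notin A) \sum_y history x t A y.
  under eq_bigr do rewrite total_history_missing.
  by rewrite sumr_const card_ord mulr_natl.
rewrite [X in _ <= X](exchange_big_dep xpredT) //= [X in X <= _]big_mkcond /=.
apply: ler_sum => A _.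
case: ifP => [AT|_]; last by apply: sumr_ge0.
have /subsetPn[i _ iA] : ~~ ([set: 'I_n] \subset A) by rewrite subTset.
by rewrite (bigD1 i) //= lerDl sumr_ge0.
Qed.

End BurnIn.

(** * Mixing time *)

Section Mixing.
Variables (R : realType) (n : nat) (nu : cube n -> R).
Hypothesis n_gt0 : (0 < n)%N.
Hypothesis nu_gt0 : positive nu.
Hypothesis nu_sum1 : \sum_y nu y = 1.

Let x0 : cube n := [ffun=> false].
Let step := kernel_step (glauber nu).

Lemma mass_le (mu : cube n -> R) (A : {set cube n}) : (forall y, 0 <= mu y) ->
  0 <= mass mu A <= \sum_y mu y.
Proof.
move=> mu0; rewrite /mass sumr_ge0 //= [X in _ <= X](bigID [in A]) /=.
by rewrite lerDl sumr_ge0.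
Qed.

(** The law at time [t] is split into the part in which every coordinate has
    been refreshed, to which entropy contraction applies, and a remainder whose
    mass bounds its contribution at all later times. *)
Lemma kernel_law_mixing (b : 'I_n -> bool -> R) (C E : R) :
    (forall i y, nu y / (nu y + nu (flip i y)) <= b i (y i)) ->
    0 <= E -> (forall y : cube n, \prod_i b i (y i) <= expR E * nu y) ->
    1 <= C -> approx_tensorization nu C ->
  forall x t s (A : {set cube n}),
    `|mass (kernel_law (glauber nu) (s + t) x) A - mass nu A| <=
    n%:R * (1 - n%:R^-1) ^+ t
      + 2 * Num.sqrt (2 * ((1 - (C * n%:R)^-1) ^+ s * (E + 1))).
Proof.
move=> hb E0 hE C1 AT x t s A.
pose h := history nu x t.
have h0 B y : 0 <= h B y by exact: history_ge0.
pose good := h [set: 'I_n]; pose bad y := \sum_(B | B != [set: 'I_n]) h B y.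
have bad0 y : 0 <= bad y by apply: sumr_ge0.
pose d := \sum_y bad y.
have d0 : 0 <= d by apply: sumr_ge0.
have d_le : d <= n%:R * (1 - n%:R^-1) ^+ t.
  by rewrite /d /bad exchange_big /=; exact: history_missing_le.
have lawE y : kernel_law (glauber nu) t x y = good y + bad y.
  by rewrite -sum_history // (bigD1 [set: 'I_n]).
have law1 : \sum_y kernel_law (glauber nu) t x y = 1.
  rewrite /kernel_law iter_sum_step // (bigD1 x) //= /dirac_mass eqxx big1 ?addr0 //.
  by move=> y /negPf ->.
have good_sum : \sum_y good y = 1 - d.
  by rewrite -law1 (eq_bigr _ (fun y _ => lawE y)) big_split /= addrK.
have d1 : d <= 1.
  have : 0 <= \sum_y good y by apply: sumr_ge0 => y _; exact: h0.
  by rewrite good_sum subr_ge0.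
have e1 : 1 <= 2 - d by lra.
have e0 : 2 - d != 0 by rewrite gt_eqF //; lra.
have i0 : 0 < (2 - d)^-1 by rewrite invr_gt0; lra.
(* adding [nu] makes the density positive and costs only a factor at most [2],
   since [nu] is stationary *)
pose mu y := (2 - d)^-1 * (good y + nu y).
have mu0 : positive mu by move=> y; rewrite mulr_gt0 // ltr_wpDl // h0.
have mu1 : \sum_y mu y = 1.
  rewrite -mulr_sumr big_split /= good_sum nu_sum1.
  by rewrite (_ : 1 - d + 1 = 2 - d) ?mulVf //; ring.
have law_split : kernel_law (glauber nu) t x =
    (fun z => (2 - d) * mu z + 1 * (1 * bad z + (- 1) * nu z)).
  by apply/funext => z; rewrite lawE /mu; field.
have massE : mass (kernel_law (glauber nu) (s + t) x) A - mass nu A =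
    (2 - d) * (mass (iter s step mu) A - mass nu A)
    + (mass (iter s step bad) A - d * mass nu A).
  have -> : mass (kernel_law (glauber nu) (s + t) x) A =
      (2 - d) * mass (iter s step mu) A + (mass (iter s step bad) A - mass nu A).
    rewrite /kernel_law iterD -/(kernel_law _ t x) law_split /mass.
    rewrite mulr_sumr -sumrB -big_split; apply: eq_bigr => y _ /=.
    by rewrite iter_stepL mul1r iter_stepL mul1r mulN1r iter_step_nu.
  ring.
have ms0 := iter_step_gt0 n_gt0 nu_gt0 s mu0.
have ms1 : \sum_y iter s step mu y = 1 by rewrite iter_sum_step.
have ent0 : ent nu (density nu mu) <= E + 1.
  have f0 := density_gt0 nu_gt0 mu0.
  have F1 : avg nu (density nu mu) = 1 by rewrite avg_density // mu1 /tot nu_sum1 divr1.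
  rewrite /ent F1.
  have -> : E + 1 = avg nu (fun y => (E + 1) * density nu mu y) by rewrite avgZ F1 mulr1.
  apply: (ler_avg x0) => // y; rewrite divr1 [X in X <= _]mulrC ler_pM2r // -ler_expR lnK ?posrE //.
  have gy : good y <= expR E * nu y.
    apply: le_trans (history_full_le nu_gt0 hb x t y) _.
    apply: le_trans (hE y); rewrite ler_piMl //.
      apply: prodr_ge0 => i _; apply: le_trans (hb i y).
      by rewrite divr_ge0 ?addr_ge0 // ltW.
    by rewrite -/h -/good good_sum; lra.
  rewrite /density ler_pdivrMr // /mu.
  have g1 : good y + nu y <= expR (E + 1) * nu y.
    have eE : 1 <= expR E by rewrite -expR0 ler_expR.
    have e2 : 2 <= expR 1 :> R by have := @expR_ge1Dx R 1.
    have : expR E + 1 <= expR (E + 1) by rewrite expRD; nra.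
    move=> /(ler_wpM2r (ltW (nu_gt0 y))); lra.
  apply: le_trans g1; rewrite ler_piMl ?invf_le1 //; last by lra.
  by rewrite addr_ge0 ?h0 // ltW.
set Z := 2 * (_ * (E + 1)); rewrite massE.
have dev : `|mass (iter s step mu) A - mass nu A| <= Num.sqrt Z.
  have dev2 : (mass (iter s step mu) A - mass nu A) ^+ 2 <= Z.
    apply: le_trans (mass_dev_le nu_gt0 A ms0 ms1 nu_sum1) _.
    rewrite ler_pM2l //; apply: le_trans (ent_iter_step n_gt0 nu_gt0 s C1 AT mu0) _.
    rewrite ler_wpM2l // exprn_ge0 // subr_ge0 invf_le1.
      by rewrite mulr_ege1 // ler1n.
    by rewrite mulr_gt0 ?ltr0n //; lra.
  by rewrite -sqrtr_sqr ler_wsqrtr.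
have [b1 b2] := andP (mass_le A (iter_step_ge0 nu_gt0 s bad0)).
rewrite iter_sum_step // -/d in b2.
have [n1 n2] := andP (mass_le A (fun y => ltW (nu_gt0 y))).
rewrite nu_sum1 in n2.
have r : `|mass (iter s step bad) A - d * mass nu A| <= d.
  have dn1 : 0 <= d * mass nu A by rewrite mulr_ge0.
  have dn2 : d * mass nu A <= d by rewrite ler_piMr.
  rewrite ler_norml -/step; rewrite -/step in b1 b2; lra.
apply: le_trans (ler_normD _ _) _; rewrite addrC; apply: lerD.
  exact: le_trans r d_le.
rewrite normrM ger0_norm; last by lra.
by apply: ler_pM => //; lra.
Qed.

End Mixing.

Section IsingBounds.
Variables (R : realType) (n : nat) (J : 'M[R]_n) (v : 'cV[R]_n) (q : R).
Hypothesis q0 : 0 < q.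
Hypothesis q2 : q < 1 / 2.
Hypothesis J_pos : posdefmx J.
Hypothesis J_norm : opnorm J <= q.

(** The probability of the sign [s] at [i] when only the external field
    acts. *)
Definition field_marginal (i : 'I_n) (s : bool) : R :=
  expR ((-1) ^+ s * v i 0) / (expR (v i 0) + expR (- v i 0)).

Lemma ising_gt0 : positive (ising J v).
Proof.
have W0 : positive (ising_weight J v) by move=> x; exact: expR_gt0.
by move=> x; rewrite divr_gt0 //; exact: (tot_gt0 x).
Qed.

Lemma ising_sum1 : \sum_y ising J v y = 1.
Proof.
have W0 : positive (ising_weight J v) by move=> x; exact: expR_gt0.
rewrite -mulr_suml divff // gt_eqF //; exact: (tot_gt0 [ffun=> false]).
Qed.

Lemma ising_tensorization :
  approx_tensorization (ising J v) (tensorization_const q).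
Proof.
have W0 : positive (ising_weight J v) by move=> x; exact: expR_gt0.
have -> : ising J v = fun x => (tot (ising_weight J v))^-1 * ising_weight J v x.
  by apply/funext => x; rewrite mulrC.
apply: approx_tensorization_scale => //.
  by rewrite gt_eqF // invr_gt0; exact: (tot_gt0 [ffun=> false]).
exact: ising_weight_tensorization.
Qed.

Lemma quad_spins_bounds (x : cube n) :
  0 <= dotp (spins R x) (J *m spins R x) <= n%:R.
Proof.
apply/andP; split.
  have [_ pJ] := J_pos; have [->|t0] := eqVneq (spins R x) 0; first by rewrite dotp0l.
  exact/ltW/pJ.
apply: le_trans (quad_le_opnorm _ J_norm) _; rewrite spins_sqr.
have qh := q2; have qp := q0; rewrite ler_piMl //; lra.
Qed.

(** The quadratic form takes values between [0] and [q n <= n] on the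
    hypercube. *)
Lemma ising_weight_bounds (x : cube n) :
  field_weight v x <= ising_weight J v x <= expR n%:R * field_weight v x.
Proof.
have /andP[Q0 Qn] := quad_spins_bounds x.
rewrite /ising_weight expRD (dotpC _ v) /field_weight /lin.
rewrite ler_pM2r ?expR_gt0 // ler_expR Qn andbT ler_peMl ?expR_ge0 //.
by rewrite -expR0 ler_expR.
Qed.

(** Removing the interaction changes a conditional probability by a factor at
    most [exp n]. *)
Lemma ising_conditional_le i (y : cube n) :
  ising J v y / (ising J v y + ising J v (flip i y)) <=
  expR n%:R * field_marginal i (y i).
Proof.
have W0 (x : cube n) : 0 < ising_weight J v x by exact: expR_gt0.
set Z := tot (ising_weight J v); have Z0 : 0 < Z by exact: (tot_gt0 y).
have -> : ising J v y / (ising J v y + ising J v (flip i y)) =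
    ising_weight J v y / (ising_weight J v y + ising_weight J v (flip i y)).
  by rewrite /ising -/Z; field; rewrite !lt0r_neq0 ?addr_gt0.
have /andP[a1 a2] := ising_weight_bounds y.
have /andP[b1 _] := ising_weight_bounds (flip i y).
have f0 := @field_weight_gt0 R n v.
apply: (@le_trans _ _ (expR n%:R * field_weight v y
    / (field_weight v y + field_weight v (flip i y)))).
  apply: ler_pM => //; first exact: ltW.
    by rewrite invr_ge0 ltW // addr_gt0.
  by rewrite lef_pV2 ?posrE ?addr_gt0 // lerD.
rewrite -mulrA ler_pM2l ?expR_gt0 // field_weight_flip /field_marginal.
set w := field_weight v y; have w0 : 0 < w by exact: f0.
set s := (-1) ^+ y i.
have -> : w / (w + w * expR (- (2 * v i 0 * spin R i y))) =
    expR (s * v i 0) / (expR (s * v i 0) + expR (- (s * v i 0))).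
  rewrite (_ : - (2 * _ * _) = - (s * v i 0) + - (s * v i 0)); last first.
    by rewrite /spin -/s; ring.
  rewrite expRD !expRN; set e := expR _; have e0 : 0 < e by exact: expR_gt0.
  by field; rewrite !lt0r_neq0 // ?addr_gt0 ?mulr_gt0.
rewrite /s; case: (y i) => /=; rewrite ?expr1 ?expr0 ?mulN1r ?mul1r ?opprK //.
by rewrite (addrC (expR (- _))).
Qed.

Lemma prod_field_marginal (y : cube n) :
  \prod_i field_marginal i (y i) = field_weight v y / tot (field_weight v).
Proof.
have wE (z : cube n) : field_weight v z = \prod_i expR ((-1) ^+ z i * v i 0).
  rewrite /field_weight linE expR_sum; apply: eq_bigr => i _.
  by rewrite mulrC.
rewrite /field_marginal prodf_div -wE; congr (_ / _).
rewrite /tot (eq_bigr _ (fun z _ => wE z)).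
rewrite -(bigA_distr_bigA (fun i s => expR ((-1) ^+ (s : bool) * v i 0))) /=.
apply: eq_bigr => i _; rewrite big_bool /= expr1 expr0 mulN1r mul1r addrC //.
Qed.

Lemma prod_field_marginal_le (y : cube n) :
  \prod_i (expR n%:R * field_marginal i (y i)) <=
  expR (n%:R ^+ 2 + n%:R) * ising J v y.
Proof.
have W0 : positive (ising_weight J v) by move=> x; exact: expR_gt0.
have Z0 := tot_gt0 y W0; have F0 := tot_gt0 y (field_weight_gt0 v).
rewrite big_split /= prod_field_marginal prodr_const card_ord -expRM_natl.
rewrite expRD -mulrA -expr2 ler_pM2l ?expR_gt0 // /ising -/(tot _).
rewrite ler_pdivrMr //.
have /andP[a1 _] := ising_weight_bounds y.
have t : tot (ising_weight J v) <= expR n%:R * tot (field_weight v).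
  by rewrite /tot mulr_sumr; apply: ler_sum => x _; have /andP[] := ising_weight_bounds x.
set F := tot (field_weight v) in F0 t *; set Z := tot (ising_weight J v) in Z0 t *.
have -> : expR n%:R * (ising_weight J v y / Z) * F =
    ising_weight J v y * (expR n%:R * F) / Z.
  by field; rewrite gt_eqF.
rewrite ler_pdivlMr //; apply: ler_pM => //; first exact/ltW/field_weight_gt0.
exact: ltW.
Qed.

End IsingBounds.

Section Numerics.
Variable R : realType.

Lemma pow_decay (D Y : R) (k : nat) : 1 <= D -> 0 < Y -> D * ln Y <= k%:R ->
  (1 - D^-1) ^+ k <= Y^-1.
Proof.
move=> D1 Y0 h; have D0 : 0 < D by lra.
have d0 : 0 <= 1 - D^-1 by rewrite subr_ge0 invf_le1.
apply: (@le_trans _ _ (expR (- D^-1) ^+ k)).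
  by rewrite lerXn2r ?nnegrE ?expR_ge0 // expR_ge1Dx.
rewrite -expRM_natl -[Y]lnK ?posrE // -expRN ler_expR mulrN lerN2.
by rewrite ler_pdivlMr // mulrC.
Qed.

Lemma nat_ceil (X : R) : 0 <= X -> exists2 k : nat, (0 < k)%N & X <= k%:R <= X + 1.
Proof.
move=> X0; exists (Num.truncn X).+1 => //.
have /andP[a b] := truncn_itv X0.
by rewrite (ltW b) /= mulrS addrC lerD2r.
Qed.

End Numerics.

Theorem corollary51 (R : realType) (q eps : R)
    (hq0 : 0 < q) (hq : q < 1 / 2) (heps0 : 0 < eps) (heps1 : eps < 1) :
  exists C : R,
    forall (n : nat) (J : 'M[R]_n) (v : 'cV[R]_n),
      (2 <= n)%N -> posdefmx J -> opnorm J <= q ->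
      (tmix (glauber (ising J v)) (ising J v) eps <= (C * n%:R * ln n%:R)%:E)%E.
Proof.
pose C := tensorization_const q.
have C1 : 1 <= C.
  apply: le_trans (expR_ge1Dx _).
  have : 0 <= 16 * q * (2 / (1 - 2 * q)).
    by apply: mulr_ge0; [lra|apply: divr_ge0; lra].
  by set K := 16 * q * _; clearbody K; lra.
pose l2 : R := ln 2; have l20 : 0 < l2 by rewrite ln_gt0 // ltr1n.
pose c1 := ln (2 / eps) / l2; pose c2 := ln (32 / eps ^+ 2) / l2.
have eps2 : 0 < eps ^+ 2 by rewrite exprn_gt0.
have c10 : 0 <= ln (2 / eps).
  by rewrite ln_ge0 // ler_pdivlMr //; lra.
have c20 : 0 <= ln (32 / eps ^+ 2).
  by rewrite ln_ge0 // ler_pdivlMr //; nra.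
exists (1 + c1 + C * (3 + c2) + 2 / l2) => n J v n2 J_pos J_norm.
have n_gt0 : (0 < n)%N by exact: leq_trans n2.
have n2' : 2 <= n%:R :> R by rewrite ler_nat.
set N : R := n%:R in n2' *.
have N0 : 0 < N by lra.
pose l : R := ln N.
have l2l : l2 <= l by rewrite ler_ln ?posrE.
have l0 : 0 < l by lra.
have scale (c : R) : 0 <= c -> c <= c / l2 * l.
  by move=> c0; rewrite mulrAC ler_pdivlMr // ler_wpM2l.
pose E : R := N ^+ 2 + N.
have E0 : 0 <= E by rewrite /E; nra.
have EN : E + 1 <= N ^+ 3.
  have : 2 * N ^+ 2 <= N * N ^+ 2 by rewrite ler_wpM2r // sqr_ge0.
  by rewrite -exprS /E; nra.
have CN1 : 1 <= C * N by nra.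
pose Y1 := N * (2 / eps); pose Y2 := (E + 1) * (32 / eps ^+ 2).
have k1 : 0 < 2 / eps by rewrite divr_gt0.
have k2 : 0 < 32 / eps ^+ 2 by rewrite divr_gt0.
have Y10 : 0 < Y1 by rewrite mulr_gt0.
have E1 : 0 < E + 1 by lra.
have Y20 : 0 < Y2 by rewrite mulr_gt0.
have Y1E : ln Y1 = l + ln (2 / eps) by rewrite lnM ?posrE.
have Y2E : ln Y2 = ln (E + 1) + ln (32 / eps ^+ 2) by rewrite lnM ?posrE.
have lE : 0 <= ln (E + 1) by rewrite ln_ge0 //; lra.
have lE3 : ln (E + 1) <= 3 * l.
  by rewrite mulr_natl /l -lnXn // ler_ln ?posrE ?exprn_gt0.
have lY1 : ln Y1 <= (1 + c1) * l.
  by rewrite Y1E; have := scale _ c10; rewrite -/c1; lra.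
have lY10 : 0 <= ln Y1 by rewrite Y1E; lra.
have lY2 : ln Y2 <= (3 + c2) * l.
  by rewrite Y2E; have := scale _ c20; rewrite -/c2; lra.
have lY20 : 0 <= ln Y2 by rewrite Y2E; lra.
have [t t_gt0 /andP[t1 t2]] := nat_ceil (mulr_ge0 (ltW N0) lY10).
have CN0 : 0 <= C * N by lra.
have [s s_gt0 /andP[s1 s2]] := nat_ceil (mulr_ge0 CN0 lY20).
have time : (s + t)%:R <= (1 + c1 + C * (3 + c2) + 2 / l2) * N * l.
  rewrite natrD.
  have h1 : N * ln Y1 <= N * ((1 + c1) * l) by rewrite ler_pM2l.
  have h2 : C * N * ln Y2 <= C * N * ((3 + c2) * l) by rewrite ler_wpM2l.
  have h3 : 2 <= 2 / l2 * N * l.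
    rewrite mulrAC; have := scale 2 (ler0n R 2).
    have : 0 <= 2 / l2 * l by rewrite mulr_ge0 ?ltW // divr_gt0.
    nra.
  lra.
apply: bigmax_le => [|x _]; first exact: leNye.
apply: (@le_trans _ _ ((s + t)%:R%:E)); last by rewrite lee_fin.
apply: ereal_inf_lbound => /=; exists (s + t)%N => //; split; first by rewrite addn_gt0 s_gt0.
move=> A.
have mixing := @kernel_law_mixing R n _ n_gt0 (ising_gt0 J v) (ising_sum1 J v)
  (fun i s => expR n%:R * field_marginal v i s) C E
  (ising_conditional_le v hq0 hq J_pos J_norm) E0
  (prod_field_marginal_le v hq0 hq J_pos J_norm) C1
  (ising_tensorization v hq0 hq J_pos J_norm) x t s A.
apply: le_trans mixing _; rewrite -/N.
have p1 : N * (1 - N^-1) ^+ t <= eps / 2.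
  have N1 : 1 <= N by lra.
  have := pow_decay N1 Y10 t1.
  rewrite -(ler_pM2l N0) => /le_trans; apply.
  by rewrite /Y1 le_eqVlt; apply/orP; left; apply/eqP; field; rewrite !gt_eqF.
have p2 : Num.sqrt (2 * ((1 - (C * N)^-1) ^+ s * (E + 1))) <= eps / 4.
  have -> : eps / 4 = Num.sqrt ((eps / 4) ^+ 2).
    by rewrite sqrtr_sqr ger0_norm // divr_ge0 // ltW.
  apply: ler_wsqrtr.
  have := pow_decay CN1 Y20 s1.
  rewrite -(ler_pM2r E1) => h.
  have : (1 - (C * N)^-1) ^+ s * (E + 1) <= eps ^+ 2 / 32.
    apply: le_trans h _.
    by rewrite /Y2 le_eqVlt; apply/orP; left; apply/eqP; field; rewrite !gt_eqF.
  by lra.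
lra.
Qed.
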